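(* Let $f\in\mathbb{S}_d$ and let $\mathbb{V}\subseteq\mathbb{S}_d$ be a $\mathcal{T}$-invariant open set which contains the constant function $d^*(f)\mathbf{1}$. Then $\mathcal{Z}_tf\in\mathbb{V}$ for all sufficiently large real $t$.
   Context: $\mathbb{S}_d$ denotes the set of all $f\in L^\infty(\mathbb{R}^d)$ with $0\le f\le1$ almost everywhere, with the weak-* topology inherited from $L^\infty(\mathbb{R}^d)\simeq L^1(\mathbb{R}^d)^*$; $\mathbf{1}$ is the constant function $1$. For $v\in\mathbb{R}^d$, $\mathcal{T}_v\colon\mathbb{S}_d\to\mathbb{S}_d$ is $(\mathcal{T}_vf)(x)=f(x+v)$; for $t>0$, $\mathcal{Z}_t\colon\mathbb{S}_d\to\mathbb{S}_d$ is $(\mathcal{Z}_tf)(x)=f(tx)$. A set $B\subseteq\mathbb{S}_d$ is $\mathcal{T}$-invariant if $\mathcal{T}_vB=B$ for all $v\in\mathbb{R}^d$. With $m$ Lebesgue measure and $Q(v,t)$ the closed axis-parallel cube of centre $v$ and side $t$, the upper Banach density of $f\in\mathbb{S}_d$ is $d^*(f):=\limsup_{t\to\infty}\sup_{v\in\mathbb{R}^d}\frac{1}{m(Q(v,t))}\int_{Q(v,t)}f(x)\,dx$. *)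

(* Defs.v *)
From HB Require Import structures.
From mathcomp Require Import all_boot all_order all_algebra.
From mathcomp Require Import all_classical all_reals all_analysis.

Set Implicit Arguments.
Unset Strict Implicit.
Unset Printing Implicit Defensive.

Import Order.TTheory GRing.Theory Num.Theory.
Local Open Scope classical_set_scope.
Local Open Scope ring_scope.

(* Points of R^d are d-tuples of reals (with the product Borel sigma-algebra
   provided by MathComp-Analysis on n.-tuple T). *)

Section Defs.
Variable R : realType.

(* Lebesgue integral over R^d of a nonnegative function, as the iterated
   integral of one-dimensional Lebesgue integrals (Tonelli). *)
Fixpoint iint (d : nat) : (d.-tuple R -> \bar R) -> \bar R :=
  match d with
  | 0 => fun F => F [tuple]
  | d'.+1 => fun F =>
      (\int[@lebesgue_measure R]_x iint (fun y : d'.-tuple R => F [tuple of x :: y]))%E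
  end.

Variable d : nat.

Definition tadd (x v : d.-tuple R) : d.-tuple R := [tuple tnth x i + tnth v i | i < d].
Definition tscale (t : R) (x : d.-tuple R) : d.-tuple R := [tuple t * tnth x i | i < d].

(* S_d : (Borel representatives of) measurable functions with 0 <= f <= 1. *)
Definition Sd : set (d.-tuple R -> R) :=
  [set f : d.-tuple R -> R | measurable_fun setT f /\ forall x, 0 <= f x <= 1].

Definition transl (v : d.-tuple R) (f : d.-tuple R -> R) : d.-tuple R -> R :=
  fun x => f (tadd x v).
Definition dil (t : R) (f : d.-tuple R -> R) : d.-tuple R -> R :=
  fun x => f (tscale t x).

Definition T_invariant (B : set (d.-tuple R -> R)) : Prop :=
  forall v, transl v @` B = B.

Definition integrable_d (g : d.-tuple R -> R) : Prop :=
  measurable_fun setT g /\ (iint (fun x => (`|g x|)%:E) < +oo)%E.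

Definition posp (g : d.-tuple R -> R) := fun x => Num.max (g x) 0.
Definition negp (g : d.-tuple R -> R) := fun x => Num.max (- g x) 0.

Definition pairing (h g : d.-tuple R -> R) : \bar R :=
  (iint (fun x => (h x * posp g x)%:E) - iint (fun x => (h x * negp g x)%:E))%E.

(* V is open in S_d for the weak-* topology of L^infty = (L^1)^*:
   every f in V has a basic weak-* neighbourhood whose trace on S_d lies in V. *)
Definition weakstar_open_in_Sd (V : set (d.-tuple R -> R)) : Prop :=
  V `<=` Sd /\
  forall f, V f ->
    exists (n : nat) (gs : 'I_n -> (d.-tuple R -> R)) (eps : R),
      (forall i, integrable_d (gs i)) /\ 0 < eps /\
      forall h, Sd h ->
        (forall i, (`|pairing h (gs i) - pairing f (gs i)| < eps%:E)%E) -> V h.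

Definition cube (v : d.-tuple R) (t : R) : set (d.-tuple R) :=
  [set x | forall i : 'I_d, `|tnth x i - tnth v i| <= t / 2].

Definition cube_avg (f : d.-tuple R -> R) (v : d.-tuple R) (t : R) : \bar R :=
  (((t ^+ d)^-1)%:E * iint (fun x => (\1_(cube v t) x * f x)%:E))%E.

(* Upper Banach density: limsup_{t -> oo} sup_v (average of f over Q(v,t)),
   the limsup written out as inf_{T>0} sup_{t>T}. *)
Definition upper_banach_density (f : d.-tuple R -> R) : \bar R :=
  ereal_inf [set ereal_sup [set y | exists v t, T < t /\ y = cube_avg f v t]
            | T in [set T : R | 0 < T]].

End Defs.

(* Main.v *)
(* The upper Banach density D makes large cubes asymptotically uniform from
   above: every average of f over a large cube is at most D + o(1), whereas
   some arbitrarily large cubes have average at least D - o(1). Let g >= 0 be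
   integrable.

   Upper bound: g is L^1-close to its translates by vectors of a small cube, so
   averaging int f(t(y + v)) g(y) dy over such translations replaces f by its
   averages over cubes of side comparable to t; hence the integral is at most
   D int g + o(1) as t -> oo, uniformly in v.

   Lower bound: averaging the same integral over all v such that tv lies in a
   huge cube of average at least D - o(1) gives at least D int g - o(1), because
   such an average hardly changes when the cube is recentred by ty; so some v
   does at least as well as the average.

   Given a basic weak-* neighbourhood of D defined by g_1, ..., g_n, choose v by
   the lower bound for the sum of all positive and negative parts of the g_i.
   The upper bound for each part then forces near-equality for each part
   separately, so T_v Z_t f lies in the neighbourhood, and translation
   invariance yields Z_t f. *)

Require Import Defs.
From HB Require Import structures.
From mathcomp Require Import all_boot all_order all_algebra.
From mathcomp Require Import all_classical all_reals all_analysis.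
From mathcomp Require Import measurable_realfun ring lra.
Import Order.TTheory GRing.Theory Num.Theory.
Import numFieldNormedType.Exports.
Local Open Scope classical_set_scope.
Local Open Scope ring_scope.

(** * Lebesgue measure on tuples *)

Section lebesgue_real.
Context {R : realType}.

(* Lebesgue measure for the sigma-algebra carried by the type [R] itself (the
   one used by [d.-tuple R]); [lebesgue_measure] lives on [measurableTypeR R],
   whose display is a different one. *)
Definition lebR : set R -> \bar R := @lebesgue_measure R.

Let lebR0 : lebR set0 = 0%E. Proof. exact: (measure0 (@lebesgue_measure R)). Qed.
Let lebR_ge0 A : (0 <= lebR A)%E. Proof. exact: (measure_ge0 (@lebesgue_measure R)). Qed.
Let lebR_sigma_additive : semi_sigma_additive lebR.
Proof. exact: (@measure_semi_sigma_additive _ _ _ (@lebesgue_measure R)). Qed.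
HB.instance Definition _ := isMeasure.Build _ _ _ lebR lebR0 lebR_ge0 lebR_sigma_additive.

Let lebR_sigma_finite : sigma_finite setT lebR.
Proof. exact: (sigma_finiteT (@lebesgue_measure R)). Qed.
HB.instance Definition _ := Measure_isSigmaFinite.Build _ _ _ lebR lebR_sigma_finite.

Let idR : measurableTypeR R -> R := idfun.
Let midR : measurable_fun setT idR. Proof. by move=> _ A mA; rewrite setTI. Qed.

(** [lebR] is the pushforward of Lebesgue measure along the identity [idR], which is measurable
    between the two structures on the line. *)
Lemma integral_lebR (D : set R) (f : R -> \bar R) : measurable D -> measurable_fun D f ->
  {in D, forall x, 0 <= f x}%E ->
  (\int[@lebesgue_measure R]_(x in D) f x = \int[lebR]_(x in D) f x)%E.
Proof. by move=> mD mf f0; rewrite -(ge0_integral_pushforward midR). Qed.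

Lemma integrable_lebR (D : set R) (f : R -> \bar R) : measurable D ->
  (@lebesgue_measure R).-integrable D f <-> lebR.-integrable D f.
Proof.
move=> mD; split=> /integrableP[mf fo]; apply/integrableP; split.
- exact: mf.
- by rewrite -integral_lebR//; exact: measurableT_comp.
- exact: mf.
- by rewrite integral_lebR//; exact: measurableT_comp.
Qed.
End lebesgue_real.

Section cons_measure.
Context {R : realType} (n : nat).
Variable m : {sigma_finite_measure set (n.-tuple R) -> \bar R}.

Definition tcons (p : R * n.-tuple R) : n.+1.-tuple R := [tuple of p.1 :: p.2].

Lemma measurable_tcons : measurable_fun setT tcons.
Proof. exact: measurable_cons. Qed.

Lemma measurable_tuncons : measurable_fun setT
  (fun x : n.+1.-tuple R => (thead x, [tuple of behead x])).
Proof.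
apply: measurable_fun_pair; first exact: measurable_tnth.
exact: measurable_behead.
Qed.

Definition cons_measure := pushforward (lebR \x m)%E tcons.

HB.instance Definition _ := Measure.copy cons_measure
  (measure_function_pushforward__canonical__measure_function_Measure
    (lebR \x m)%E measurable_tcons).

(** Diagonal products [F i] by [G i] of two exhausting sequences suffice: both sequences increase,
    so a point of [F i] times [G j] lies in the product of index [maxn i j]. *)
Let cons_measure_sigma_finite : sigma_finite setT cons_measure.
Proof.
have /sigma_finiteP[F [FT ndF mF]] := sigma_finiteT (@lebR R).
have /sigma_finiteP[G [GT ndG mG]] := sigma_finiteT m.
pose uncons (x : n.+1.-tuple R) := (thead x, [tuple of behead x]).
exists (fun i => uncons @^-1` (F i `*` G i)).
  rewrite -preimage_bigcup (_ : \bigcup_i _ = setT) ?preimage_setT//.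
  apply/seteqP; split=> // -[x y] _.
  have [i _ Fi] : (\bigcup_i F i) x by rewrite -FT.
  have [j _ Gj] : (\bigcup_i G i) y by rewrite -GT.
  exists (maxn i j) => //; split.
    by move: x Fi; exact/subsetPset/ndF/leq_maxl.
  by move: y Gj; exact/subsetPset/ndG/leq_maxr.
move=> i; have [mFi Fi] := mF i; have [mGi Gi] := mG i; split.
  by rewrite -[X in measurable X]setTI; apply: measurable_tuncons => //; exact: measurableX.
rewrite [X in (X < _)%E](_ : _ = (lebR \x m)%E (F i `*` G i)).
  by rewrite product_measure1E// lte_mul_pinfty// ge0_fin_numE.
congr ((lebR \x m)%E _); apply/funext => -[x y] /=.
by congr (_ /\ G i _); apply/val_inj.
Qed.

HB.instance Definition _ :=
  @Measure_isSigmaFinite.Build _ _ _ cons_measure cons_measure_sigma_finite.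

End cons_measure.

Section tuple_lebesgue.
Context {R : realType}.

(** The recursion on the head coordinate mirrors that of [iint]; the unit mass at the empty tuple
    matches evaluation there. *)
Fixpoint leb (d : nat) : {sigma_finite_measure set (d.-tuple R) -> \bar R} :=
  match d with
  | 0 => \d_([tuple] : 0.-tuple R)
  | d'.+1 => cons_measure d' (leb d')
  end.

Local Open Scope ereal_scope.

Lemma integral_leb0 (F : 0.-tuple R -> \bar R) :
  measurable_fun setT F -> \int[leb 0]_x F x = F [tuple].
Proof. by move=> mF; rewrite integral_dirac// diracT mul1e. Qed.

Lemma integral_lebS n (F : n.+1.-tuple R -> \bar R) :
  measurable_fun setT F -> (forall x, 0 <= F x) ->
  \int[leb n.+1]_x F x = \int[lebR]_x \int[leb n]_y F [tuple of x :: y].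
Proof.
move=> mF F0.
rewrite /= (ge0_integral_pushforward (measurable_tcons n))//.
rewrite preimage_setT fubini_tonelli1//.
by apply: measurableT_comp => //; exact: measurable_tcons.
by move=> x /=; exact: F0.
Qed.

Lemma measurable_cons_section n (F : n.+1.-tuple R -> \bar R) x :
  measurable_fun setT F ->
  measurable_fun setT (fun y : n.-tuple R => F [tuple of x :: y]).
Proof.
move=> mF; apply: measurableT_comp => //.
by apply: measurable_cons.
Qed.

(** Tonelli, one coordinate at a time. It replaces iterated integrals by integrals against a single
    sigma-finite measure, for which dominated convergence and exchange of integrals are at hand. *)
Lemma iintE d (F : d.-tuple R -> \bar R) :
  measurable_fun setT F -> (forall x, 0 <= F x) ->
  iint F = \int[leb d]_x F x.
Proof.
elim: d F => [|d IH] F mF F0; first by rewrite integral_leb0.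
rewrite integral_lebS// -integral_lebR//=.
- by apply: eq_integral => x _; rewrite IH//; exact: measurable_cons_section.
- apply: (measurable_fun_fubini_tonelli_F (F \o tcons d)) => [|x]; last exact: F0.
  by apply: measurableT_comp => //; exact: measurable_tcons.
- by move=> x _; exact: integral_ge0.
Qed.

End tuple_lebesgue.

(** * Affine changes of variables *)

Section affine_change.
Context {R : realType}.
Local Open Scope ereal_scope.

(** The image of Lebesgue measure under [t * x + a], multiplied by [t], gives half-open intervals
    their length, so it is Lebesgue measure by uniqueness. *)
Lemma ge0_integral_lebR_affine (t a : R) (F : R -> \bar R) : (0 < t)%R ->
  measurable_fun setT F -> (forall x, 0 <= F x) ->
  t%:E * \int[lebR]_x F (t * x + a)%R = \int[lebR]_x F x.
Proof.
move=> t0 mF F0.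
pose phi (x : R) : measurableTypeR R := (t * x + a)%R.
have mphi : measurable_fun setT phi.
  have : measurable_fun setT (fun x : R => t * x + a)%R.
    by apply: measurable_funD => //; exact: measurable_funM.
  by [].
pose p : {measure set (measurableTypeR R) -> \bar R} :=
  measure_function_pushforward__canonical__measure_function_Measure (@lebR R) mphi.
pose nu := mscale (NngNum (ltW t0)) p.
have nuE A : measurable A -> nu A = @lebesgue_measure R A.
  move=> mA; apply/esym/lebesgue_measure_unique => //= _ [[b c]] _ <-.
  rewrite /nu /mscale /= /pushforward.
  rewrite (_ : phi @^-1` _ = `](b - a) / t, (c - a) / t]%classic)%R; last first.
    apply/seteqP; split=> x /=; rewrite !in_itv/= ltr_pdivrMr// ler_pdivlMr//;
      by rewrite mulrC ltrBlDr lerBrDr.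
  rewrite /lebR !lebesgue_measure_itv/= !lte_fin ltr_pM2r ?invr_gt0// ltrD2r.
  case: ifP => _; last by rewrite mule0.
  by rewrite -!EFinB -EFinM; congr EFin; field; exact: lt0r_neq0.
rewrite -[RHS]integral_lebR//.
rewrite (eq_measure_integral nu); last by move=> A mA _; exact/esym/nuE.
rewrite /nu ge0_integral_mscale//=.
by rewrite (ge0_integral_pushforward mphi).
Qed.

Context (d : nat).

Lemma measurable_tadd d1 (T : measurableType d1) (f g : T -> d.-tuple R) :
  measurable_fun setT f -> measurable_fun setT g ->
  measurable_fun setT (fun x => tadd (f x) (g x)).
Proof.
move=> mf mg; apply/measurable_fun_tnthP => i.
rewrite (_ : _ \o _ = (fun x => tnth (f x) i + tnth (g x) i)%R); last first.
  by apply/funext => x /=; rewrite tnth_mktuple.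
by apply: measurable_funD; apply: (measurableT_comp (measurable_tnth i)).
Qed.

Lemma measurable_tscale d1 (T : measurableType d1) (t : R) (f : T -> d.-tuple R) :
  measurable_fun setT f -> measurable_fun setT (fun x => tscale t (f x)).
Proof.
move=> mf; apply/measurable_fun_tnthP => i.
rewrite (_ : _ \o _ = (fun x => t * tnth (f x) i)%R); last first.
  by apply/funext => x /=; rewrite tnth_mktuple.
by apply: measurable_funM => //; apply: (measurableT_comp (measurable_tnth i)).
Qed.

End affine_change.

Lemma tadd_tscale_cons (R : realType) d (t a x : R) (v y : d.-tuple R) :
  tadd (tscale t [tuple of x :: y]) [tuple of a :: v] =
  [tuple of (t * x + a) :: tadd (tscale t y) v].
Proof.
apply: eq_from_tnth => i; rewrite !tnth_mktuple.
case: (unliftP ord0 i) => [j|] ->; last by rewrite !tnth0.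
by rewrite !tnthS !tnth_mktuple.
Qed.

Lemma ge0_integral_leb_affine (R : realType) d (t : R) (v : d.-tuple R)
    (F : d.-tuple R -> \bar R) : (0 < t)%R ->
  measurable_fun setT F -> (forall x, 0 <= F x)%E ->
  ((t ^+ d)%:E * \int[leb d]_x F (tadd (tscale t x) v) = \int[leb d]_x F x)%E.
Proof.
move=> t0; elim: d v F => [|d IH] v F mF F0.
  rewrite !integral_leb0//; last first.
    apply: measurableT_comp => //; apply: measurable_tadd => //.
    exact: measurable_tscale.
  by rewrite expr0 mul1e; congr F; apply: eq_from_tnth => -[].
have mA : measurable_fun setT (fun x : d.+1.-tuple R => F (tadd (tscale t x) v)).
  apply: measurableT_comp => //; apply: measurable_tadd => //.
  exact: measurable_tscale.
rewrite !integral_lebS//.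
case/tupleP: v mA => a v mA.
rewrite exprS EFinM.
under eq_integral do under eq_integral do rewrite tadd_tscale_cons.
set G := fun z => (\int[leb d]_y F [tuple of z :: y])%E.
have mG : measurable_fun setT G.
  apply: (measurable_fun_fubini_tonelli_F (m2 := leb d) (F \o tcons d)) => [|x]; last exact: F0.
  by apply: measurableT_comp => //; exact: measurable_tcons.
have G0 x : (0 <= G x)%E by exact: integral_ge0.
(* The outer substitution accounts for one factor [t]; the remaining [t ^+ d] goes inside, to the
   induction hypothesis for each section. *)
rewrite -(@ge0_integral_lebR_affine _ t a G)// -muleA; congr (_ * _)%E.
rewrite -ge0_integralZl//; last first.
- by rewrite lee_fin exprn_ge0// ltW.
- by move=> x _; exact: integral_ge0.
- apply: (measurable_fun_fubini_tonelli_F (m2 := leb d) 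
    (fun p => F [tuple of t * p.1 + a :: tadd (tscale t p.2) v])) => //.
  apply: measurableT_comp => //; apply: measurable_cons.
    by apply: measurable_funD => //; apply: measurable_funM.
  by apply: measurable_tadd => //; exact: measurable_tscale.
apply: eq_integral => x _; rewrite (IH v (fun y => F [tuple of t * x + a :: y]))//.
exact: measurable_cons_section.
Qed.

(** * Continuity of translations in L^1 *)

Section section_convergence.
Local Open Scope ereal_scope.
Context d1 d2 (T : measurableType d1) (S : measurableType d2) (R : realType).
Context (m : {sigma_finite_measure set T -> \bar R}).
Context (s : {sigma_finite_measure set S -> \bar R}).
Context (tau : nat -> S -> S).
Context (mtau : forall n, measurable_fun setT (tau n)).
Context (tau_inv : forall n (k : S -> \bar R), measurable_fun setT k ->
  (forall y, 0 <= k y) -> \int[s]_y k (tau n y) = \int[s]_y k y).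
Context (tau_cvg : forall k : S -> R, s.-integrable setT (EFin \o k) ->
  \int[s]_y `|k (tau n y) - k y|%:E @[n --> \oo] --> 0).

(* Lets Fubini propagate continuity of translations one coordinate at a time. *)
Lemma cvg_integral_section (G : T * S -> R) : measurable_fun setT G ->
  \int[m]_x \int[s]_y `|G (x, y)|%:E < +oo ->
  \int[m]_x \int[s]_y `|G (x, tau n y) - G (x, y)|%:E @[n --> \oo] --> 0.
Proof.
move=> mG fG.
pose N x := \int[s]_y `|G (x, y)|%:E.
have mGn : measurable_fun setT (fun p => `|G p|%:E).
  by apply/measurable_EFinP; exact: measurableT_comp.
have mN : measurable_fun setT N.
  exact: (measurable_fun_fubini_tonelli_F (m2 := s) (fun p => `|G p|%:E)).
have N0 x : 0 <= N x by exact: integral_ge0.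
have iN : m.-integrable setT N.
  by apply/integrableP; split=> //; under eq_integral do rewrite gee0_abs//.
have mGx x : measurable_fun setT (fun y => G (x, y)).
  by apply: measurableT_comp.
have mGt n : measurable_fun setT (fun p => G (p.1, tau n p.2)).
  apply: measurableT_comp => //; apply: measurable_fun_pair => //.
  exact: measurableT_comp.
have mD n : measurable_fun setT
    (fun p : T * S => `|G (p.1, tau n p.2) - G (p.1, p.2)|%:E).
  apply/measurable_EFinP; apply: measurableT_comp => //.
  apply: measurable_funB => //.
  by rewrite (_ : (fun x => _) = G)//; apply/funext => -[].
(* By [tau_inv] a section and its image have the same norm [N x], so their distance is at most
   [2 * N x], whatever [n]. *)
have := @dominated_convergence _ _ _ m setT measurableT
  (fun n x => \int[s]_y `|G (x, tau n y) - G (x, y)|%:E) (cst 0) (fun x => 2%:E * N x).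
case.
- move=> n.
  exact: (measurable_fun_fubini_tonelli_F (m2 := s)
    (fun p : T * S => `|G (p.1, tau n p.2) - G (p.1, p.2)|%:E)).
- exact: measurable_cst.
(* Almost every section has finite norm, and [tau_cvg] applies to those. *)
- have := integrable_ae measurableT iN; apply: filterS => x /(_ Logic.I) Nx _.
  apply: (tau_cvg (fun y => G (x, y))); apply/integrableP; split.
    exact/measurable_EFinP.
  by rewrite -ge0_fin_numE//; exact: integral_ge0.
- by apply: integrableZl.
- apply: aeW => x n _; rewrite gee0_abs; last exact: integral_ge0.
  have -> : 2%:E * N x = \int[s]_y (`|G (x, tau n y)|%:E + `|G (x, y)|%:E).
    rewrite ge0_integralD//; last 2 first.
    - apply/measurable_EFinP; apply: measurableT_comp => //; exact: (measurableT_comp (mGx x)).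
    - by apply/measurable_EFinP; apply: measurableT_comp.
    rewrite (tau_inv n (fun y => `|G (x, y)|%:E))//.
      by rewrite mule_natl mule2n.
    by apply/measurable_EFinP; apply: measurableT_comp.
  apply: ge0_le_integral => //.
  - apply/measurable_EFinP; apply: measurableT_comp => //.
    by apply: measurable_funB => //; exact: (measurableT_comp (mGx x)).
  - apply: emeasurable_funD; apply/measurable_EFinP.
      by apply: measurableT_comp => //; exact: (measurableT_comp (mGx x)).
    by apply: measurableT_comp.
  - by move=> y _; rewrite -EFinD lee_fin ler_normB.
by move=> _ _; rewrite integral0.
Qed.
End section_convergence.

Section ereal_cvg0.
Context {R : realType}.
Local Open Scope ereal_scope.

(** Convergence to a finite limit in the extended reals means eventual finiteness together with
    convergence of the real parts; the bound with [e = 1] yields the former. *)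
Lemma ge0_cvge0P (a : (\bar R)^nat) : (forall n, 0 <= a n) ->
  a @ \oo --> 0 <-> forall e : R, (0 < e)%R -> \forall n \near \oo, a n <= e%:E.
Proof.
move=> a0; split.
  move=> /fine_cvgP[afin /cvgrPdist_le ac] e /ac ce; near=> n.
  have nfin : a n \is a fin_num by near: n.
  rewrite -(fineK nfin) lee_fin.
  have : (`|0 - (fine \o a) n| <= e)%R by near: n.
  by rewrite sub0r normrN/= ger0_norm// fine_ge0.
move=> H; apply/fine_cvgP; split.
  near=> n; rewrite ge0_fin_numE//; apply: (@le_lt_trans _ _ 1%:E); last exact: ltry.
  by near: n; exact: H.
apply/cvgrPdist_le => e /H He; near=> n.
have ae : a n <= e%:E by near: n.
rewrite sub0r normrN/= ger0_norm ?fine_ge0//.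
rewrite -lee_fin fineK// ge0_fin_numE//; apply: (le_lt_trans ae); exact: ltry.
Unshelve. all: by end_near. Qed.

End ereal_cvg0.

(** * Continuity of translations on the line *)

Section translation_real.
Context {R : realType}.
Local Open Scope ereal_scope.
Implicit Types g h k : R -> R.

(** The integrals over [[-n, n]] increase to the full integral, which is finite, so the integrals
    over the complements tend to zero. *)
Lemma integral_tail_le g (e : R) : (0 < e)%R -> lebR.-integrable setT (EFin \o g) ->
  exists2 M : R, (0 < M)%R &
    \int[lebR]_(x in ~` `[(- M)%R, M]%classic) `|g x|%:E <= e%:E.
Proof.
move=> e0 /integrableP[/measurable_EFinP mg ig].
have nn x : 0 <= `|g x|%:E by rewrite lee_fin.
pose F (i : nat) : set R := `[(- i%:R)%R, i%:R]%classic.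
have mF i : measurable (F i) by exact: measurable_itv.
have mgn : measurable_fun setT (fun x => `|g x|%:E).
  by apply/measurable_EFinP; apply: measurableT_comp.
have FT : \bigcup_i F i = setT.
  apply/seteqP; split=> // x _; exists (Num.truncn `|x|%R).+1 => //=.
  by rewrite /F/= in_itv/= -ler_norml ltW// truncnS_gt.
have ndF : {homo F : n m / (n <= m)%N >-> (n <= m)%O}.
  move=> i j ij; apply/subsetPset => x; rewrite /F /= !in_itv/= -!ler_norml => /le_trans; apply.
  by rewrite ler_nat.
have mgF A : measurable_fun A (fun x => `|g x|%:E) by exact: measurable_funTS.
have cv := @ge0_nondecreasing_set_cvg_integral _ _ R F (fun x => `|g x|%:E) lebR
  ndF mF (fun i => mgF _) (fun _ _ _ => nn _).
rewrite FT in cv.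
have Ifin : \int[lebR]_x `|g x|%:E \is a fin_num.
  by rewrite ge0_fin_numE//; exact: integral_ge0.
have split n : \int[lebR]_x `|g x|%:E =
    \int[lebR]_(x in F n) `|g x|%:E + \int[lebR]_(x in ~` F n) `|g x|%:E.
  rewrite -(setUv (F n)) ge0_integral_setU//; first exact: measurableC.
  exact/disj_setPCl.
have bfin n : \int[lebR]_(x in F n) `|g x|%:E \is a fin_num.
  rewrite ge0_fin_numE; last exact: integral_ge0.
  apply: le_lt_trans ig; rewrite [leRHS](split n) leeDl//; exact: integral_ge0.
have : \int[lebR]_(x in ~` F n) `|g x|%:E @[n --> \oo] --> 0.
  rewrite -(subee Ifin).
  rewrite (_ : (fun n => _) = (fun n => \int[lebR]_x `|g x|%:E - \int[lebR]_(x in F n) `|g x|%:E)).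
    apply: cvgeB cv; last exact: cvg_cst.
    by rewrite fin_num_adde_defr.
  by apply/funext => n; rewrite (split n) addeAC subee// add0e.
move/ge0_cvge0P => /(_ (fun n => integral_ge0 _ (fun x _ => nn x)) _ e0)[N _ HN].
(* The successor keeps the radius positive when [N] is zero. *)
exists N.+1%:R => //; exact: (HN N.+1 (leqnSn N)).
Qed.

Lemma continuous_itv_bounded h (M : R) : continuous h ->
  exists2 C : R, (0 < C)%R & forall x, `[(- M)%R, M]%classic x -> (`|h x| <= C)%R.
Proof.
move=> ch.
have : compact (h @` `[(- M)%R, M]%classic).
  apply: continuous_compact; last exact: segment_compact.
  exact: continuous_subspaceT.
move=> /(@compact_bounded _ R^o)[C [Cr HC]].
exists (`|C| + 1)%R; first by rewrite ltr_wpDl.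
by move=> x xM; apply: (HC (`|C| + 1)%R); [rewrite ltr_pwDr// ler_norm|exists x].
Qed.

End translation_real.

Section translation_real.
Context {R : realType}.
Local Open Scope ereal_scope.

(** Half of [e] pays for the tail outside [[-M, M]], half for the approximation by a continuous
    function inside. The cutoff stays a sharp indicator, so the approximant need not be continuous
    at the endpoints. *)
Lemma integrable_near_compact_continuous (g : R -> R) (e : R) : (0 < e)%R ->
  lebR.-integrable setT (EFin \o g) ->
  exists (M : R) (h : R -> R), [/\ (0 < M)%R, continuous h &
    \int[lebR]_x `|g x - h x * \1_(`[(- M)%R, M]%classic) x|%:E <= e%:E].
Proof.
move=> e0 ig.
have e20 : (0 < e / 2)%R by rewrite divr_gt0.
have [M M0 HM] := integral_tail_le _ _ e20 ig.
pose E : set R := `[(- M)%R, M]%classic.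
have mE : measurable E by exact: measurable_itv.
have mu_E : @lebesgue_measure R E < +oo.
  by rewrite /E lebesgue_measure_itv/=; case: ifP => _; exact: ltry.
have [|h_ [hc hi hcv]] := @approximation_continuous_integrable R E g mE mu_E.
  by apply/integrable_lebR => //; exact: integrableS ig.
have mg : measurable_fun setT g.
  by case/integrableP : ig => /measurable_EFinP.
have := ge0_cvge0P (fun n => \int[lebesgue_measure]_(z in E) `|(g z - h_ n z)%:E|).
case=> [n|/(_ hcv _ e20)[N _ /(_ N (leqnn N)) /= HN] _]; first exact: integral_ge0.
exists M, (h_ N); split => //.
have mh : measurable_fun setT (h_ N) by exact: continuous_measurable_fun.
have mD : measurable_fun setT (fun x => `|g x - h_ N x * \1_E x|%:E).
  apply/measurable_EFinP; apply: measurableT_comp => //.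
  by apply: measurable_funB => //; apply: measurable_funM.
rewrite -/E -(setUv E) ge0_integral_setU//; last 3 first.
- exact: measurableC.
- by rewrite setUv.
- exact/disj_setPCl.
rewrite [e]splitr EFinD; apply: leeD.
  apply: le_trans HN; rewrite [leRHS]integral_lebR//; last first.
    apply: measurable_funTS; apply/measurable_EFinP;
    apply: measurableT_comp => //; exact: measurable_funB.
  apply: ge0_le_integral => //=.
  - exact: measurable_funTS mD.
  - apply: measurable_funTS; apply/measurable_EFinP;
    apply: measurableT_comp => //; exact: measurable_funB.
  - by move=> x Ex; rewrite indicE mem_set// mulr1.
rewrite (le_trans _ HM)//; apply: ge0_le_integral => //=.
- exact: measurableC.
- exact: measurable_funTS.
- by apply: measurable_funTS; apply/measurable_EFinP; exact: measurableT_comp.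
- by move=> x Ex; rewrite indicE memNset// mulr0 subr0.
Qed.

Lemma lebR_shift (a : R) (F : R -> \bar R) :
  measurable_fun setT F -> (forall x, 0 <= F x) ->
  \int[lebR]_x F (x + a)%R = \int[lebR]_x F x.
Proof.
move=> mF F0; rewrite -(@ge0_integral_lebR_affine _ 1 a F)// mul1e.
by under [in RHS]eq_integral do rewrite mul1r.
Qed.

(* [k] may jump at the two endpoints only. *)
Lemma cvg_shift_continuous_itv (h : R -> R) (M : R) (u : R^nat) :
  continuous h -> u @ \oo --> 0%R ->
  let k x := (h x * \1_(`[(- M)%R, M]%classic) x)%R in
  \int[lebR]_x `|k (x + u n)%R - k x|%:E @[n --> \oo] --> 0.
Proof.
move=> ch u0 k.
have [C C0 hC] := continuous_itv_bounded _ M ch.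
have [B [Br HB]] : bounded_fun u by apply: cvg_seq_bounded; apply/cvg_ex; exists 0%R.
pose B1 : R := (`|B| + 1)%R.
have uB n : (`|u n| <= B1)%R by apply: HB => //; rewrite ltr_pwDr// ler_norm.
have mh : measurable_fun setT h by exact: continuous_measurable_fun.
have mk : measurable_fun setT k by apply: measurable_funM.
have kC x : (`|k x| <= C * \1_(`[(- M)%R, M]%classic) x)%R.
  rewrite /k indicE; case: (boolP (x \in _)) => [|_]; last by rewrite !mulr0 normr0.
  by rewrite inE !mulr1 => /hC.
(* Away from the endpoints [k] coincides near [x] with [h] or with zero. *)
have kcont x : x != M -> x != (- M)%R -> {for x, continuous k}.
  move=> xM xNM; have [xltM|] := ltP `|x|%R M.
    have kh : \forall y \near x, h y = k y.
      have xI : x \in `](- M)%R, M[ by rewrite in_itv/= -ltr_norml.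
      near=> y; rewrite /k indicE mem_set ?mulr1//.
      by apply: subset_itv_oo_cc; near: y; exact: near_in_itvoo xI.
    change (k y @[y --> x] --> k x); rewrite -(nbhs_singleton kh).
    exact: cvg_trans (near_eq_cvg kh) (ch x).
  rewrite le_eqVlt => /predU1P[xE|Mx].
    by move: xM xNM; rewrite xE; case: (ger0P x) => _; rewrite ?opprK eqxx.
  have kh : \forall y \near x, 0%R = k y.
    move: Mx; rewrite lter_normr => /orP[] Mx.
      have xI : x \in `]M, +oo[ by rewrite in_itv/= Mx.
      near=> y; rewrite /k indicE memNset ?mulr0//=.
      have : y \in `]M, +oo[ by near: y; exact: near_in_itvoy xI.
      by rewrite !in_itv/= andbT => My /andP[_]; rewrite leNgt My.
    have xI : x \in `]-oo, (- M)%R[ by rewrite in_itv/= ltrNr.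
    near=> y; rewrite /k indicE memNset ?mulr0//=.
    have : y \in `]-oo, (- M)%R[ by near: y; exact: near_in_itvNyo xI.
    by rewrite !in_itv/= => My /andP[]; rewrite leNgt My.
  change (k y @[y --> x] --> k x); rewrite -(nbhs_singleton kh).
  exact: cvg_trans (near_eq_cvg kh) (cvg_cst _).
(* A majorant valid for all [n] at once: the interval is enlarged by the bound [B1] on the shifts,
   and [C] is counted once for each of the two terms. *)
pose G (x : R) : R := ((C *+ 2) * \1_(`[(- (M + B1))%R, (M + B1)%R]%classic) x)%R.
have kG n x : (`| k (x + u n)%R - k x| <= G x)%R.
  apply: le_trans (ler_normB _ _) _; rewrite /G mulr2n mulrDl.
  have IE (y : R) : (`|x - y| <= B1)%R -> (\1_(`[(- M)%R, M]%classic) y <=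
      \1_(`[(- (M + B1))%R, (M + B1)%R]%classic) x :> R)%R.
    move=> xy; rewrite !indicE; case: (boolP (y \in _)) => [|_]; last by rewrite ler0n.
    rewrite inE/= in_itv/= => /andP[? ?]; rewrite mem_set//= in_itv/=.
    move: xy; rewrite ler_norml => /andP[? ?]; apply/andP; split; lra.
  apply: lerD; apply: (le_trans (kC _)); (apply: ler_wpM2l; [exact: ltW|apply: IE]).
    rewrite (_ : x - (x + u n) = - u n)%R ?normrN; first exact: uB.
    by ring.
  by rewrite subrr normr0 (le_trans _ (uB n)).
have mG : measurable_fun setT G by apply: measurable_funM.
have := @dominated_convergence _ _ _ (@lebR R) setT measurableT
  (fun n x => `|k (x + u n)%R - k x|%:E) (cst 0) (EFin \o G).
case.
- move=> n; apply/measurable_EFinP; apply: measurableT_comp => //.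
  apply: measurable_funB => //; apply: measurableT_comp => //.
  exact: measurable_funD.
- exact: measurable_cst.
(* The two endpoints form the exceptional null set for pointwise convergence. *)
- exists [set M; (- M)%R]; split.
  + by apply: measurableU; exact: measurable_set1.
  + apply: countable_lebesgue_measure0; apply: finite_set_countable; exact: finite_set2.
  + move=> x /= /not_implyP[_ Hx]; apply: contrapT => /not_orP[/eqP xM /eqP xNM].
    apply: Hx; apply/fine_cvgP; split; first exact: nearW.
    rewrite -(normr0 R) -[X in `|X|%R](subrr (k x)).
    apply: cvg_norm; apply: cvgB; last exact: cvg_cst.
    have xu : (x + u n)%R @[n --> \oo] --> (x + 0)%R by apply: cvgD => //; exact: cvg_cst.
    by rewrite addr0 in xu; exact: (cvg_comp _ _ xu (kcont x xM xNM)).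
- apply/integrableP; split; first exact/measurable_EFinP.
  rewrite (eq_integral (fun x : R => (C *+ 2)%:E *
     (\1_(`[(- (M + B1))%R, (M + B1)%R]%classic) x)%:E)); last first.
    move=> x _; rewrite -EFinM /= ger0_norm// /G mulr_ge0// ?mulrn_wge0// ltW//.
  rewrite ge0_integralZl//; last 2 first.
  - exact/measurable_EFinP.
  - by rewrite lee_fin mulrn_wge0// ltW.
  rewrite integral_indic// setIT lte_mul_pinfty//.
  - by rewrite lee_fin mulrn_wge0// ltW.
  - change (@lebesgue_measure R `[(- (M + B1))%R, (M + B1)%R]%classic < +oo).
    by rewrite lebesgue_measure_itv/=; case: ifP => _; exact: ltry.
- by apply: aeW => x n _; rewrite lee_fin normr_id; exact: kG.
by move=> _ _; rewrite integral0.
Unshelve. all: by end_near. Qed.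

(** Compare [g] with its truncated continuous approximant [k]: by invariance [g - k] and its
    translate each cost [e / 4], and the translation of [k] costs [e / 2]. *)
Lemma lebR_translation_cvg (g : R -> R) (u : R^nat) :
  lebR.-integrable setT (EFin \o g) -> u @ \oo --> 0%R ->
  \int[lebR]_x `|g (x + u n)%R - g x|%:E @[n --> \oo] --> 0.
Proof.
move=> ig u0; apply/ge0_cvge0P; first by move=> n; exact: integral_ge0.
move=> e e0; have e40 : (0 < e / 4)%R by rewrite divr_gt0.
have [M [h [M0 ch He]]] := integrable_near_compact_continuous _ _ e40 ig.
set k := fun x => (h x * \1_(`[(- M)%R, M]%classic) x)%R in He.
have e20 : (0 < e / 2)%R by rewrite divr_gt0.
have /ge0_cvge0P := cvg_shift_continuous_itv _ M _ ch u0.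
case/(_ (fun n => integral_ge0 _ (fun x _ => _)) _ e20) => [n x _|].
  by rewrite lee_fin.
move=> N _ HN; exists N => // n /HN /= {HN}.
have mg : measurable_fun setT g.
  by case/integrableP : ig => /measurable_EFinP.
have mh : measurable_fun setT h by exact: continuous_measurable_fun.
have mk : measurable_fun setT k by apply: measurable_funM.
have ms : measurable_fun setT (fun x : R => x + u n)%R by exact: measurable_funD.
rewrite -/k => HN.
have mgk : measurable_fun setT (fun x : R => `|g x - k x|%:E).
  by apply/measurable_EFinP; apply: measurableT_comp => //; exact: measurable_funB.
have mgks : measurable_fun setT (fun x : R => `|g (x + u n)%R - k (x + u n)%R|%:E).
  exact: (measurableT_comp mgk).
have mkk : measurable_fun setT (fun x : R => `|k (x + u n)%R - k x|%:E).
  apply/measurable_EFinP; apply: measurableT_comp => //; apply: measurable_funB => //.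
  exact: (measurableT_comp mk).
apply: (@le_trans _ _ (\int[lebR]_x (`|g (x + u n)%R - k (x + u n)%R|%:E +
    (`|k (x + u n)%R - k x|%:E + `|g x - k x|%:E)))).
  apply: ge0_le_integral => //.
  - apply/measurable_EFinP; apply: measurableT_comp => //; apply: measurable_funB => //.
    exact: (measurableT_comp mg).
  - by apply: emeasurable_funD => //; apply: emeasurable_funD.
  - move=> x _; rewrite -!EFinD lee_fin.
    rewrite [X in (_ + (_ + X))%R]distrC.
    rewrite (_ : g (x + u n) - g x = (g (x + u n) - k (x + u n)) +
      ((k (x + u n) - k x) + (k x - g x)))%R; last by ring.
    apply: (le_trans (ler_normD _ _)); rewrite lerD2l; exact: ler_normD.
rewrite !ge0_integralD//; last exact: emeasurable_funD.
rewrite (lebR_shift (u n) (fun x => `|g x - k x|%:E))//.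
rewrite (_ : e = e / 4 + (e / 2 + e / 4))%R; last by field.
by rewrite !EFinD; apply: leeD => //; apply: leeD.
by move=> x _; exact: adde_ge0.
Qed.
End translation_real.

(** * Continuity of translations in every dimension *)

Section translation.
Context {R : realType}.
Local Open Scope ereal_scope.

Lemma tadd_cons d (a x : R) (v y : d.-tuple R) :
  tadd [tuple of x :: y] [tuple of a :: v] = [tuple of (x + a)%R :: tadd y v].
Proof.
apply: eq_from_tnth => i; rewrite !tnth_mktuple.
case: (unliftP ord0 i) => [j|] ->; last by rewrite !tnth0.
by rewrite !tnthS !tnth_mktuple.
Qed.

Lemma tscale1 d (x : d.-tuple R) : tscale 1 x = x.
Proof. by apply: eq_from_tnth => i; rewrite tnth_mktuple mul1r. Qed.

Lemma ge0_integral_leb_shift d (v : d.-tuple R) (F : d.-tuple R -> \bar R) :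
  measurable_fun setT F -> (forall x, 0 <= F x) ->
  \int[leb d]_x F (tadd x v) = \int[leb d]_x F x.
Proof.
move=> mF F0; rewrite -(@ge0_integral_leb_affine _ _ 1%R v F)// expr1n mul1e.
by under [in RHS]eq_integral do rewrite tscale1.
Qed.

(** A translation splits into one of the head and one of the tail. The head is the one-dimensional
    case, the tail the induction hypothesis, each integrated over the other variable. *)
Lemma leb_translation_cvg d (g : d.-tuple R -> R) (u : nat -> d.-tuple R) :
  (leb d).-integrable setT (EFin \o g) ->
  (forall i, tnth (u n) i @[n --> \oo] --> 0%R) ->
  \int[leb d]_x `|g (tadd x (u n)) - g x|%:E @[n --> \oo] --> 0.
Proof.
elim: d g u => [|d IH] g u ig u0.
  rewrite (_ : (fun n => _) = cst 0); first exact: cvg_cst.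
  apply/funext => n; apply: integral0_eq => x _.
  by rewrite (_ : tadd x (u n) = x) ?subrr ?normr0//; apply: eq_from_tnth => -[].
have mg : measurable_fun setT g by case/integrableP : ig => /measurable_EFinP.
pose a n := thead (u n); pose v n := [tuple of behead (u n)].
have uE n : u n = [tuple of a n :: v n] by exact: tuple_eta.
have a0 : a @ \oo --> 0%R by exact: (u0 ord0).
have v0 i : tnth (v n) i @[n --> \oo] --> 0%R.
  have := u0 (lift ord0 i); rewrite (_ : (fun n => tnth (u n) _) = (fun n => tnth (v n) i))//.
  by apply/funext => n; rewrite uE tnthS.
have mgn : measurable_fun setT (fun x => `|g x|%:E).
  by apply/measurable_EFinP; exact: measurableT_comp.
have gfin : \int[lebR]_x \int[leb d]_y `|g [tuple of x :: y]|%:E < +oo.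
  rewrite -(@integral_lebS _ d (fun x => `|g x|%:E))//.
  by case/integrableP : ig.
have mgc : measurable_fun setT (g \o tcons d).
  by apply: measurableT_comp => //; exact: measurable_tcons.
have A0 : \int[lebR]_x \int[leb d]_y `|g [tuple of x :: tadd y (v n)] - g [tuple of x :: y]|%:E
    @[n --> \oo] --> 0.
  apply: (@cvg_integral_section _ _ _ _ R lebR (leb d)
    (fun n y => tadd y (v n)) _ _ _ (g \o tcons d)) => //.
  - by move=> n; exact: measurable_tadd.
  - by move=> n k mk k0; exact: ge0_integral_leb_shift.
  - by move=> k ik; exact: IH.
(* The variables are exchanged here, so that the coordinate being moved is the inner one. *)
have B0 : \int[leb d]_y \int[lebR]_x `|g [tuple of (x + a n)%R :: y] - g [tuple of x :: y]|%:E
    @[n --> \oo] --> 0.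
  apply: (@cvg_integral_section _ _ _ _ R (leb d) lebR
    (fun n x => (x + a n)%R) _ _ _ (g \o tcons d \o (fun p => (p.2, p.1)))) => //.
  - by move=> n; exact: measurable_funD.
  - by move=> n k mk k0; exact: lebR_shift.
  - by move=> k ik; exact: lebR_translation_cvg.
  - apply: measurableT_comp => //; exact: measurable_fun_pair.
  - rewrite -(fubini_tonelli (fun p : R * d.-tuple R => `|g (tcons d p)|%:E))//.
    by apply/measurable_EFinP; apply: measurableT_comp.
apply/ge0_cvge0P; first by move=> n; exact: integral_ge0.
move=> e e0; have e20 : (0 < e / 2)%R by rewrite divr_gt0.
have /ge0_cvge0P := A0.
case/(_ (fun n => integral_ge0 _ (fun x _ => integral_ge0 _ (fun y _ => _))) _ e20)
  => [n x _ y _|N _ HA].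
  by rewrite lee_fin.
have /ge0_cvge0P := B0.
case/(_ (fun n => integral_ge0 _ (fun x _ => integral_ge0 _ (fun y _ => _))) _ e20)
  => [n x _ y _|N' _ HB].
  by rewrite lee_fin.
exists (maxn N N') => // n /=; rewrite geq_max => /andP[Nn N'n].
have {HA} /= HA := HA n Nn; have {HB} /= HB := HB n N'n.
have mt d1 (T : measurableType d1) (p : T -> R) (q : T -> d.-tuple R) :
    measurable_fun setT p -> measurable_fun setT q ->
    measurable_fun setT (fun x => g [tuple of p x :: q x]).
  by move=> mp mq; apply: measurableT_comp => //; exact: measurable_cons.
have mva y : measurable_fun setT y ->
    measurable_fun setT (fun x : R * d.-tuple R => tadd (y x) (v n)).
  by move=> my; exact: measurable_tadd.
pose F1 (p : R * d.-tuple R) := `|g [tuple of p.1 :: tadd p.2 (v n)] - g [tuple of p.1 :: p.2]|%:E.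
pose F2 (p : R * d.-tuple R) := `|g [tuple of (p.1 + a n)%R :: p.2] - g [tuple of p.1 :: p.2]|%:E.
have F1p p : 0 <= F1 p by rewrite lee_fin.
have F2p p : 0 <= F2 p by rewrite lee_fin.
have mF1 : measurable_fun setT F1.
  apply/measurable_EFinP; apply: measurableT_comp => //; apply: measurable_funB; apply: mt => //.
  exact: mva.
have mF2 : measurable_fun setT F2.
  apply/measurable_EFinP; apply: measurableT_comp => //; apply: measurable_funB; apply: mt => //.
  exact: measurable_funD.
have mG1 : measurable_fun setT (fun x => \int[leb d]_y F1 (x, y)).
  by apply: (measurable_fun_fubini_tonelli_F (m2 := leb d) F1) => // x; rewrite lee_fin.
have mG2 : measurable_fun setT (fun x => \int[leb d]_y F2 (x, y)).
  by apply: (measurable_fun_fubini_tonelli_F (m2 := leb d) F2) => // x; rewrite lee_fin.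
have mF (p : R -> R) : measurable_fun setT p ->
    forall x, measurable_fun setT (fun y => F1 (p x, y)).
  by move=> mp x; exact: (measurableT_comp mF1).
have mF2x x : measurable_fun setT (fun y => F2 (x, y)).
  exact: (measurableT_comp mF2).
have msh : measurable_fun setT (fun x : R => x + a n)%R by exact: measurable_funD.
rewrite integral_lebS//; last first.
  apply/measurable_EFinP; apply: measurableT_comp => //; apply: measurable_funB => //.
  apply: measurableT_comp => //; exact: measurable_tadd.
(* Triangle inequality through the point whose head alone has moved. Invariance in the head then
   removes [a n] from the [F1] term. *)
apply: (@le_trans _ _ (\int[lebR]_x (\int[leb d]_y F1 ((x + a n)%R, y) + \int[leb d]_y F2 (x, y)))).
  apply: ge0_le_integral => //.
  - by move=> x _; exact: integral_ge0.
  - apply: (measurable_fun_fubini_tonelli_F (m2 := leb d) (fun p =>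
      `|g (tadd (tcons d p) (u n)) - g (tcons d p)|%:E)) => //.
    apply/measurable_EFinP; apply: measurableT_comp => //; apply: measurable_funB => //.
    apply: measurableT_comp => //; apply: measurable_tadd => //; exact: measurable_tcons.
  - apply: emeasurable_funD => //; exact: (measurableT_comp mG1).
  - move=> x _; rewrite -ge0_integralD//.
    + apply: ge0_le_integral => //.
      * apply/measurable_EFinP; apply: measurableT_comp => //; apply: measurable_funB => //.
          apply: measurableT_comp => //; apply: measurable_tadd => //; exact: measurable_cons.
        exact: mt.
      * apply: emeasurable_funD => //; exact: (mF _ msh).
      * move=> y _; rewrite uE tadd_cons /F1 /F2/= -EFinD lee_fin.
        by rewrite -(subrKA (g [tuple of (x + a n)%R :: y])) ler_normD.
    + exact: (mF _ msh).
rewrite ge0_integralD//; last 3 first.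
- by move=> x _; exact: integral_ge0.
- exact: (measurableT_comp mG1).
- by move=> x _; exact: integral_ge0.
rewrite (lebR_shift (a n) (fun x => \int[leb d]_y F1 (x, y)))//; last first.
  by move=> x; exact: integral_ge0.
rewrite [in leLHS](fubini_tonelli F2)//.
by rewrite [e]splitr EFinD; apply: leeD.
Qed.

End translation.

(** * Averages over cubes and the upper Banach density *)

Section unit_cube.
Context {R : realType}.
Local Open Scope ereal_scope.

Definition unit_cube d : set (d.-tuple R) := cube [tuple 0%R | i < d] 1.

Lemma in_unit_cube d (x : d.-tuple R) :
  unit_cube d x <-> forall i, (`|tnth x i| <= 2^-1)%R.
Proof.
by split=> H i; move: (H i); rewrite tnth_mktuple subr0 div1r.
Qed.

Lemma measurable_cube d (v : d.-tuple R) t : measurable (cube v t).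
Proof.
rewrite (_ : cube v t = \bigcap_(i in [set: 'I_d])
   (fun x : d.-tuple R => tnth x i) @^-1` `[(tnth v i - t / 2)%R, (tnth v i + t / 2)%R]%classic).
  apply: fin_bigcap_measurable => [|i _]; first exact: finite_finset.
  rewrite -[X in measurable X]setTI; exact: (measurable_tnth i measurableT (measurable_itv _)).
apply/seteqP; split=> x xv i => [_|]; first by rewrite /= in_itv/= -ler_distl; exact: xv.
by have := xv i Logic.I; rewrite /= in_itv/= -ler_distl.
Qed.

(** It serves as a probability density: averaging over a cube is integration against it after
    rescaling. *)
Definition box {d} (x : d.-tuple R) : R := \1_(unit_cube d) x.

Lemma measurable_box d : measurable_fun setT (@box d).
Proof. by apply: measurable_indic; exact: measurable_cube. Qed.

Lemma box_ge0 d (x : d.-tuple R) : (0 <= box x)%R.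
Proof. by rewrite /box indicE ler0n. Qed.

Lemma box1 d (x : d.-tuple R) : unit_cube d x -> box x = 1%R.
Proof. by move=> xK; rewrite /box indicE mem_set. Qed.

Lemma box0 d (x : d.-tuple R) : ~ unit_cube d x -> box x = 0%R.
Proof. by move=> xK; rewrite /box indicE memNset. Qed.

Lemma box_cons d (x : R) (y : d.-tuple R) :
  box [tuple of x :: y] = (\1_(`[(- 2^-1)%R, 2^-1%R]%classic) x * box y)%R.
Proof.
rewrite -natrM /box !indicE; congr (_%:R)%R; rewrite mulnb; congr nat_of_bool.
apply/idP/andP; rewrite !inE.
  move=> /in_unit_cube xy; split.
    by have := xy ord0; rewrite tnth0 /= in_itv/= ler_norml.
  by apply/in_unit_cube => i; have := xy (lift ord0 i); rewrite tnthS.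
rewrite /= in_itv/= -ler_norml => -[xI /in_unit_cube yK].
apply/in_unit_cube => i; case: (unliftP ord0 i) => [j|] ->; last by rewrite tnth0.
by rewrite tnthS.
Qed.

Lemma integral_box d : \int[leb d]_x (box x)%:E = 1%:E.
Proof.
have mK n : measurable_fun setT (fun x : n.-tuple R => (box x)%:E).
  by apply/measurable_EFinP; exact: measurable_box.
have K0 n (x : n.-tuple R) : 0 <= (box x)%:E by rewrite lee_fin box_ge0.
elim: d => [|d IH].
  by rewrite integral_leb0// box1//; apply/in_unit_cube => -[].
rewrite integral_lebS//.
pose I : set R := `[(- 2^-1)%R, 2^-1%R]%classic.
have mI : measurable I by exact: measurable_itv.
transitivity (\int[lebR]_x (\1_I x)%:E).
  apply: eq_integral => x _.
  under eq_integral do rewrite box_cons EFinM.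
  rewrite ge0_integralZl//; first by rewrite IH mule1. exact: mK.
rewrite integral_indic// setIT.
change (@lebesgue_measure R I = 1%:E).
rewrite /I lebesgue_measure_itv/= lte_fin ifT; last by lra.
by rewrite -EFinB; congr EFin; field.
Qed.

(** Writes a constant as its own average, so that a bound valid at each point of the unit cube can
    be integrated. *)
Lemma integral_box_scale d (c : \bar R) : 0 <= c -> \int[leb d]_x ((box x)%:E * c) = c.
Proof.
move=> c0; rewrite ge0_integralZr//.
- by rewrite integral_box mul1e.
- by apply/measurable_EFinP; exact: measurable_box.
- by move=> x _; rewrite lee_fin box_ge0.
Qed.

End unit_cube.

Section averages.
Context {R : realType}.
Local Open Scope ereal_scope.

(** The average over the cube of centre [w] and side [L], pulled back to the unit cube so that
    centre and side occur only in the argument of [f]. *)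
Definition avg {d} (f : d.-tuple R -> R) (w : d.-tuple R) (L : R) : \bar R :=
  \int[leb d]_u (box u * f (tadd (tscale L u) w))%:E.

Lemma measurable_aff d d1 (T : measurableType d1) (L : R) (p q : T -> d.-tuple R)
    (f : d.-tuple R -> R) :
  measurable_fun setT f -> measurable_fun setT p -> measurable_fun setT q ->
  measurable_fun setT (fun x => f (tadd (tscale L (p x)) (q x))).
Proof.
move=> mf mp mq; apply: measurableT_comp => //.
by apply: measurable_tadd => //; exact: measurable_tscale.
Qed.

(** The substitution [x = L u + w] produces the factor [L ^+ d] that the normalisation cancels. *)
Lemma cube_avgE d (f : d.-tuple R -> R) w (L : R) : Sd f -> (0 < L)%R ->
  cube_avg f w L = avg f w L.
Proof.
move=> [mf f01] L0.
have f0 x : (0 <= f x)%R by case/andP: (f01 x).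
have mcf : measurable_fun setT (fun x => (\1_(cube w L) x * f x)%:E).
  apply/measurable_EFinP; apply: measurable_funM => //.
  by apply: measurable_indic; exact: measurable_cube.
have cf0 x : 0 <= (\1_(cube w L) x * f x)%:E.
  by rewrite lee_fin mulr_ge0// indicE ler0n.
rewrite /cube_avg iintE// -(@ge0_integral_leb_affine _ _ L w)// muleA -EFinM.
rewrite mulVf ?mul1e; last by rewrite expf_neq0// gt_eqF.
apply: eq_integral => u _; congr (_ * _)%:E.
rewrite /box !indicE; congr (_%:R)%R; congr nat_of_bool.
apply/idP/idP; rewrite !inE => H.
  apply/in_unit_cube => i; have := H i; rewrite !tnth_mktuple addrK normrM gtr0_norm//.
  by rewrite ler_pM2l.
move=> i; rewrite !tnth_mktuple addrK normrM gtr0_norm// ler_pM2l//.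
by move/in_unit_cube: H.
Qed.

Lemma avg_ge0 d (f : d.-tuple R -> R) w L : Sd f -> 0 <= avg f w L.
Proof.
move=> [_ f01]; apply: integral_ge0 => u _; rewrite lee_fin mulr_ge0 ?box_ge0//.
by case/andP: (f01 (tadd (tscale L u) w)).
Qed.

Lemma avg_le1 d (f : d.-tuple R -> R) w L : Sd f -> avg f w L <= 1.
Proof.
move=> [mf f01]; rewrite -(integral_box d); apply: ge0_le_integral => //.
- move=> u _; rewrite lee_fin mulr_ge0 ?box_ge0//.
  by case/andP: (f01 (tadd (tscale L u) w)).
- apply/measurable_EFinP; apply: measurable_funM; first exact: measurable_box.
  exact: measurable_aff.
- by apply/measurable_EFinP; exact: measurable_box.
- move=> u _; rewrite lee_fin ler_piMr ?box_ge0//.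
  by case/andP: (f01 (tadd (tscale L u) w)).
Qed.

Section density.
Context d (f : d.-tuple R -> R).
Context (fS : Sd f).

Lemma upper_banach_density_bounds :
  0 <= upper_banach_density f <= 1.
Proof.
apply/andP; split.
  apply: le_ereal_inf_tmp => _ [T T0 <-]; apply: le_ereal_sup_tmp.
  exists (cube_avg f [tuple 0%R | i < d] (T + 1)).
    by exists [tuple 0%R | i < d], (T + 1)%R; split=> //; rewrite ltrDl.
  by rewrite cube_avgE//; [exact: avg_ge0|rewrite addr_gt0].
apply: (@le_trans _ _ (ereal_sup [set y | exists v t, (1 < t)%R /\ y = cube_avg f v t])).
  by apply: ereal_inf_lbound; exists 1%R => //=.
apply: ge_ereal_sup => _ [v [t [t1 ->]]].
by rewrite cube_avgE//; [exact: avg_le1|exact: lt_trans t1].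
Qed.

Lemma upper_banach_density_fin : upper_banach_density f \is a fin_num.
Proof.
have /andP[D0 D1] := upper_banach_density_bounds.
by rewrite ge0_fin_numE//; apply: le_lt_trans D1 _; exact: ltry.
Qed.

Let D := fine (upper_banach_density f).

(** An index [T] at which the infimum is nearly attained works for every centre, since the supremum
    at [T] already ranges over centres. *)
Lemma avg_upper (e : R) : (0 < e)%R ->
  exists2 T : R, (0 < T)%R & forall L w, (T < L)%R -> avg f w L <= (D + e)%:E.
Proof.
move=> e0; have [_ [T T0 <-] HT] := lb_ereal_inf_adherent e0 upper_banach_density_fin.
exists T => // L w TL; rewrite EFinD fineK ?upper_banach_density_fin//.
apply: le_trans (ltW HT); apply: ereal_sup_ubound; exists w, L; split => //.
by rewrite cube_avgE//; exact: lt_trans TL.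
Qed.

(** The supremum beyond any [T] is at least the density; a cube nearly attaining it is the
    witness. *)
Lemma avg_lower (e T : R) : (0 < e)%R -> (0 < T)%R ->
  exists2 L : R, (T < L)%R & exists w, D%:E <= avg f w L + e%:E.
Proof.
move=> e0 T0.
pose S := [set y | exists v t, (T < t)%R /\ y = cube_avg f v t].
have DS : upper_banach_density f <= ereal_sup S.
  by apply: ereal_inf_lbound; exists T.
have S1 : ereal_sup S <= 1.
  apply: ge_ereal_sup => _ [v [t [t1 ->]]].
  by rewrite cube_avgE//; [exact: avg_le1|exact: lt_trans t1].
have /andP[D0 _] := upper_banach_density_bounds.
have Sfin : ereal_sup S \is a fin_num.
  rewrite ge0_fin_numE ?(le_trans D0)//; apply: le_lt_trans S1 _; exact: ltry.
have [_ [w [L [TL ->]]] HL] := ub_ereal_sup_adherent e0 Sfin.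
exists L => //; exists w; rewrite fineK ?upper_banach_density_fin//.
rewrite -cube_avgE//; last exact: lt_trans TL.
by apply: le_trans DS _; rewrite -leeBlDr// ltW.
Qed.
End density.

End averages.

(** * Averaging over translations *)

Section weak_limits.
Context {R : realType} {d : nat}.
Local Open Scope ereal_scope.
Implicit Types (f g h : d.-tuple R -> R).

Lemma taddK (y u : d.-tuple R) : tadd (tadd y (tscale (-1) u)) u = y.
Proof. by apply: eq_from_tnth => i; rewrite !tnth_mktuple; ring. Qed.

Lemma ge0_integrable g : (forall x, 0 <= g x)%R -> measurable_fun setT g ->
  \int[leb d]_x (g x)%:E < +oo -> (leb d).-integrable setT (EFin \o g).
Proof.
move=> g0 mg gfin; apply/integrableP; split; first exact/measurable_EFinP.
by under eq_integral do rewrite /= ger0_norm//.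
Qed.

(** Substitution moves the shift from [h] onto [g]; as [h] lies between 0 and 1, replacing [g] by
    its translate costs at most their L^1 distance. The upper bound uses it for the test function,
    the recentring of cubes with [box] in place of [g]. *)
Lemma integral_shift_le h g (u : d.-tuple R) :
  measurable_fun setT h -> (forall x, 0 <= h x <= 1)%R ->
  measurable_fun setT g -> (forall x, 0 <= g x)%R ->
  \int[leb d]_y (h y * g y)%:E <= \int[leb d]_y (h (tadd y u) * g y)%:E +
    \int[leb d]_y `|g (tadd y (tscale (-1) u)) - g y|%:E.
Proof.
move=> mh h01 mg g0.
have h0 x : (0 <= h x)%R by case/andP: (h01 x).
have h1 x : (h x <= 1)%R by case/andP: (h01 x).
have mt (v : d.-tuple R) (k : d.-tuple R -> R) : measurable_fun setT k ->
    measurable_fun setT (fun y => k (tadd y v)).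
  by move=> mk; apply: measurableT_comp => //; exact: measurable_tadd.
rewrite -(@ge0_integral_leb_shift _ _ (tscale (-1) u)
  (fun y => (h (tadd y u) * g y)%:E)); last 2 first.
- by apply/measurable_EFinP; apply: measurable_funM => //; exact: mt.
- by move=> x; rewrite lee_fin mulr_ge0.
under [X in _ <= X + _]eq_integral do rewrite taddK.
have mD : measurable_fun setT (fun y => `|g (tadd y (tscale (-1) u)) - g y|%:E).
  by apply/measurable_EFinP; apply: measurableT_comp => //; apply: measurable_funB => //; exact: mt.
have mhg : measurable_fun setT (fun y => h y * g (tadd y (tscale (-1) u)))%R.
  by apply: measurable_funM => //; exact: mt.
rewrite -ge0_integralD//; last 2 first.
- by move=> x _; rewrite lee_fin mulr_ge0.
- exact/measurable_EFinP.
apply: ge0_le_integral => //.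
- by move=> x _; rewrite lee_fin mulr_ge0.
- by apply/measurable_EFinP; exact: measurable_funM.
- by apply: emeasurable_funD => //; exact/measurable_EFinP.
move=> x _; rewrite -EFinD lee_fin -lerBlDl -mulrBr distrC.
by rewrite (le_trans _ (ler_piMl (normr_ge0 _) (h1 x)))// ler_wpM2l// ler_norm.
Qed.

(** By Tonelli, averaging over [w] turns the values of [f] into cube averages. The centre [c y] is
    [t(y + v)] in the upper bound and [t y + w0] in the lower. *)
Lemma integral_box_swap f g (L : R) (c : d.-tuple R -> d.-tuple R) :
  measurable_fun setT f -> (forall x, 0 <= f x)%R ->
  measurable_fun setT g -> (forall x, 0 <= g x)%R -> measurable_fun setT c ->
  \int[leb d]_w ((box w)%:E * \int[leb d]_y (f (tadd (tscale L w) (c y)) * g y)%:E) =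
  \int[leb d]_y (avg f (c y) L * (g y)%:E).
Proof.
move=> mf f0 mg g0 mc.
have mF : measurable_fun setT (fun p : d.-tuple R * d.-tuple R =>
    (box p.1 * f (tadd (tscale L p.1) (c p.2)) * g p.2)%R).
  apply: measurable_funM; last exact: measurableT_comp.
  apply: measurable_funM; first by apply: measurableT_comp => //; exact: measurable_box.
  by apply: measurable_aff => //; exact: measurableT_comp.
transitivity (\int[leb d]_w \int[leb d]_y
    (box w * f (tadd (tscale L w) (c y)) * g y)%:E).
  apply: eq_integral => w _; rewrite -ge0_integralZl//.
  - by apply: eq_integral => y _; rewrite -EFinM mulrA.
  - apply/measurable_EFinP; apply: measurable_funM => //.
    by apply: measurable_aff.
  - by move=> y _; rewrite lee_fin mulr_ge0.
  - by rewrite lee_fin box_ge0.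
rewrite (fubini_tonelli (fun p : d.-tuple R * d.-tuple R =>
  (box p.1 * f (tadd (tscale L p.1) (c p.2)) * g p.2)%:E)); last 2 first.
- exact/measurable_EFinP.
- by move=> p; rewrite lee_fin !mulr_ge0// box_ge0.
apply: eq_integral => y _; rewrite /avg -ge0_integralZr//.
- apply/measurable_EFinP; apply: measurable_funM; first exact: measurable_box.
  by apply: measurable_aff.
- by move=> w _; rewrite lee_fin mulr_ge0// box_ge0.
- by rewrite lee_fin.
Qed.

Lemma measurable_avg f (L : R) (c : d.-tuple R -> d.-tuple R) :
  measurable_fun setT f -> (forall x, 0 <= f x)%R -> measurable_fun setT c ->
  measurable_fun setT (fun y => avg f (c y) L).
Proof.
move=> mf f0 mc.
apply: (measurable_fun_fubini_tonelli_F (m2 := leb d)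
  (fun p => (box p.2 * f (tadd (tscale L p.2) (c p.1)))%:E)).
  apply/measurable_EFinP; apply: measurable_funM.
    by apply: measurableT_comp => //; exact: measurable_box.
  by apply: measurable_aff => //; exact: measurableT_comp.
by move=> p; rewrite lee_fin mulr_ge0// box_ge0.
Qed.

(** Were there no such [s], bad vectors with entries at most [1 / (n + 1)] would contradict
    convergence along sequences. *)
Lemma translation_modulus g (e : R) : (0 < e)%R ->
  (leb d).-integrable setT (EFin \o g) ->
  exists2 s : R, (0 < s)%R & forall u, (forall i, `|tnth u i| <= s)%R ->
    \int[leb d]_x `|g (tadd x u) - g x|%:E <= e%:E.
Proof.
move=> e0 ig; apply: contrapT => H.
have /choice[u Hu] : forall n : nat, exists u : d.-tuple R,
    (forall i, `|tnth u i| <= n.+1%:R^-1)%R /\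
    ~ (\int[leb d]_x `|g (tadd x u) - g x|%:E <= e%:E).
  move=> n; apply: contrapT => Hn; apply: H; exists n.+1%:R^-1%R => [|u us].
    by rewrite invr_gt0.
  by apply: contrapT => Hu; apply: Hn; exists u.
have u0 i : tnth (u n) i @[n --> \oo] --> 0%R.
  apply/norm_cvg0P; apply: (@squeeze_cvgr _ _ _ _ (cst 0%R) harmonic).
  - by apply: nearW => n; rewrite normr_ge0/=; exact: (Hu n).1.
  - exact: cvg_cst.
  - exact: cvg_harmonic.
have /ge0_cvge0P := leb_translation_cvg _ _ _ ig u0.
case/(_ (fun n => integral_ge0 _ (fun x _ => _)) _ e0) => [n x _|N _ /(_ N (leqnn N))].
  by rewrite lee_fin.
exact: (Hu N).2.
Qed.

End weak_limits.

(** * Weak limits of dilations *)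

Section dilation_limits.
Context {R : realType} {d : nat}.
Local Open Scope ereal_scope.
Implicit Types (f g h : d.-tuple R -> R).

Lemma measurable_integral_aff f g (L : R) (c : d.-tuple R -> d.-tuple R) :
  measurable_fun setT f -> (forall x, 0 <= f x)%R ->
  measurable_fun setT g -> (forall x, 0 <= g x)%R -> measurable_fun setT c ->
  measurable_fun setT (fun w => \int[leb d]_y (f (tadd (tscale L w) (c y)) * g y)%:E).
Proof.
move=> mf f0 mg g0 mc.
apply: (measurable_fun_fubini_tonelli_F (m2 := leb d)
  (fun p => (f (tadd (tscale L p.1) (c p.2)) * g p.2)%:E)).
  apply/measurable_EFinP; apply: measurable_funM; last exact: measurableT_comp.
  by apply: measurable_aff => //; exact: measurableT_comp.
by move=> p; rewrite lee_fin mulr_ge0.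
Qed.

(** The threshold precedes [v]: both ingredients, the modulus of [g] and the bound on cube averages,
    are independent of the translation. *)
Lemma integral_dil_le f g (e : R) : Sd f -> measurable_fun setT g ->
  (forall x, 0 <= g x)%R -> \int[leb d]_x (g x)%:E < +oo -> (0 < e)%R ->
  exists2 T : R, (0 <= T)%R & forall t v, (T < t)%R ->
    \int[leb d]_y (f (tscale t (tadd y v)) * g y)%:E <=
    (fine (upper_banach_density f))%:E * \int[leb d]_y (g y)%:E + e%:E.
Proof.
move=> fS mg g0 gfin e0; have [mf f01] := fS.
have f0 x : (0 <= f x)%R by case/andP: (f01 x).
set D := fine _; set A := integral _ _ _.
have A0 : 0 <= A by apply: integral_ge0 => x _; rewrite lee_fin.
have Afin : A \is a fin_num by rewrite ge0_fin_numE.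
pose I := fine A; have AE : A = I%:E by rewrite fineK.
have I0 : (0 <= I)%R by rewrite fine_ge0.
have e20 : (0 < e / 2)%R by rewrite divr_gt0.
(* With [I + 1] the quotient makes sense even if [g] has integral zero, and [I] times it is still at
   most [e / 2]. *)
have eta0 : (0 < e / 2 / (I + 1))%R by rewrite divr_gt0// ltr_wpDl.
have [T0 T00 HT0] := avg_upper _ f fS _ eta0.
have [s s0 Hs] := translation_modulus _ _ e20 (ge0_integrable _ g0 mg gfin).
(* Beyond this value the cubes of side [t * s] have side larger than [T0]. *)
exists (T0 / s)%R; first by rewrite divr_ge0// ltW.
move=> t v; rewrite ltr_pdivrMr// => Tts.
pose c (y : d.-tuple R) := tscale t (tadd y v).
have mc : measurable_fun setT c by apply: measurable_tscale; exact: measurable_tadd.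
pose h y := f (c y).
have mh : measurable_fun setT h by exact: measurableT_comp.
pose Phi w := \int[leb d]_y (f (tadd (tscale (t * s) w) (c y)) * g y)%:E.
have mPhi : measurable_fun setT Phi by exact: measurable_integral_aff.
have Phi0 w : 0 <= Phi w by apply: integral_ge0 => y _; rewrite lee_fin mulr_ge0.
have mB : measurable_fun setT (fun w : d.-tuple R => (box w)%:E).
  by apply/measurable_EFinP; exact: measurable_box.
have B0 (w : d.-tuple R) : 0 <= (box w)%:E by rewrite lee_fin box_ge0.
have X0 : 0 <= \int[leb d]_y (h y * g y)%:E.
  by apply: integral_ge0 => y _; rewrite lee_fin mulr_ge0// /h.
(* A shift of [y] by [s w] is within the modulus of [g]; after dilation it displaces the argument of
   [f] by [t s w], which sweeps a cube of side [t s]. *)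
have key w : unit_cube d w -> \int[leb d]_y (h y * g y)%:E <= Phi w + (e / 2)%:E.
  move=> /in_unit_cube wK.
  apply: le_trans (integral_shift_le h g (tscale s w) mh _ mg g0) _ => [x|]; first exact: f01.
  apply: leeD.
    rewrite le_eqVlt; apply/orP; left; apply/eqP; apply: eq_integral => y _.
    congr (f _ * _)%:E; apply: eq_from_tnth => i; rewrite !tnth_mktuple; ring.
  apply: Hs => i; rewrite !tnth_mktuple mulN1r normrN normrM gtr0_norm//.
  apply: ler_piMr; first exact: ltW.
  by apply: le_trans (wK i) _; rewrite invf_le1// ler1n.
rewrite -[leLHS](integral_box_scale d _ X0).
apply: (@le_trans _ _ (\int[leb d]_w ((box w)%:E * Phi w + (box w)%:E * (e / 2)%:E))).
  apply: ge0_le_integral => //.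
  - by move=> w _; exact: mule_ge0.
  - by apply: emeasurable_funM.
  - by apply: emeasurable_funD; apply: emeasurable_funM.
  - move=> w _; have [wK|wK] := pselect (unit_cube d w).
      by rewrite box1// !mul1e; exact: key.
    by rewrite box0// !mul0e adde0.
rewrite ge0_integralD//; last 4 first.
- by move=> w _; exact: mule_ge0.
- exact: emeasurable_funM.
- by move=> w _; rewrite mule_ge0// lee_fin ltW.
- exact: emeasurable_funM.
rewrite integral_box_scale ?lee_fin ?(ltW e20)// integral_box_swap//.
rewrite [in leRHS](splitr e) EFinD addeA leeD2r//.
apply: (@le_trans _ _ (\int[leb d]_y ((D + e / 2 / (I + 1))%:E * (g y)%:E))).
  apply: ge0_le_integral => //.
  - by move=> y _; rewrite mule_ge0 ?avg_ge0// lee_fin.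
  - by apply: emeasurable_funM; [exact: measurable_avg|exact/measurable_EFinP].
  - by apply: emeasurable_funM => //; exact/measurable_EFinP.
  - by move=> y _; rewrite lee_wpmul2r ?lee_fin//; exact: HT0.
rewrite ge0_integralZl//; last 3 first.
- exact/measurable_EFinP.
- by move=> y _; rewrite lee_fin.
- rewrite lee_fin addr_ge0 ?(ltW eta0)//.
  by rewrite fine_ge0//; case/andP: (upper_banach_density_bounds _ f fS).
rewrite -/A AE -!EFinM -EFinD lee_fin mulrDl lerD2l.
rewrite mulrAC ler_pdivrMr ?ltr_wpDl//; apply: ler_wpM2l; first exact: ltW.
by rewrite lerDl.
Qed.

(** The measure of the symmetric difference of the unit cube and its translate by [u]. *)
Definition box_shift_dist (u : d.-tuple R) : \bar R :=
  \int[leb d]_w `|box (tadd w (tscale (-1) u)) - box w|%:E.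

Lemma box_shift_dist_ge0 u : 0 <= box_shift_dist u.
Proof. by apply: integral_ge0 => w _; rewrite lee_fin. Qed.

Lemma measurable_box_shift_dist r :
  measurable_fun setT (fun x => box_shift_dist (tscale r x)).
Proof.
apply: (measurable_fun_fubini_tonelli_F (m2 := leb d)
  (fun p => `|box (tadd p.2 (tscale (-1) (tscale r p.1))) - box p.2|%:E)).
  apply/measurable_EFinP; apply: measurableT_comp => //; apply: measurable_funB.
    apply: measurableT_comp => //; first exact: measurable_box.
    by apply: measurable_tadd => //; do 2 apply: measurable_tscale.
  by apply: measurableT_comp => //; exact: measurable_box.
by move=> p; rewrite lee_fin.
Qed.

Lemma box_shift_dist_le2 u : box_shift_dist u <= 2%:E.
Proof.
have mB : measurable_fun setT (fun w : d.-tuple R => (box w)%:E).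
  by apply/measurable_EFinP; exact: measurable_box.
have mBu : measurable_fun setT (fun w : d.-tuple R => (box (tadd w (tscale (-1) u)))%:E).
  by apply: (measurableT_comp mB); exact: measurable_tadd.
have B0 (w : d.-tuple R) : 0 <= (box w)%:E by rewrite lee_fin box_ge0.
apply: (@le_trans _ _ (\int[leb d]_w ((box (tadd w (tscale (-1) u)))%:E + (box w)%:E))).
  apply: ge0_le_integral => //.
  - apply/measurable_EFinP; apply: measurableT_comp => //.
    by apply: measurable_funB; exact/measurable_EFinP.
  - exact: emeasurable_funD.
  - move=> w _; rewrite -EFinD lee_fin (le_trans (ler_normB _ _))//.
    by rewrite !ger0_norm ?box_ge0.
rewrite ge0_integralD// (ge0_integral_leb_shift _ _ (fun w => (box w)%:E))//.
by rewrite integral_box -EFinD lee_fin -[2%R]/(1 + 1)%R.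
Qed.

(** Dominated convergence along a hypothetical sequence of counterexamples tending to zero: the
    distance tends to zero for each [x], and [2 g] dominates. *)
Lemma integral_box_shift_dist_small g (e : R) : measurable_fun setT g ->
  (forall x, 0 <= g x)%R -> \int[leb d]_x (g x)%:E < +oo -> (0 < e)%R ->
  exists2 s : R, (0 < s)%R & forall r, (0 < r <= s)%R ->
    \int[leb d]_x ((g x)%:E * box_shift_dist (tscale r x)) <= e%:E.
Proof.
move=> mg g0 gfin e0; apply: contrapT => H.
have /choice[r Hr] : forall n : nat, exists r : R, (0 < r <= n.+1%:R^-1)%R /\
    ~ (\int[leb d]_x ((g x)%:E * box_shift_dist (tscale r x)) <= e%:E).
  move=> n; apply: contrapT => Hn; apply: H; exists n.+1%:R^-1%R => [|r rs].
    by rewrite invr_gt0.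
  by apply: contrapT => Hu; apply: Hn; exists r.
have r0 : r @ \oo --> 0%R.
  apply: (@squeeze_cvgr _ _ _ _ (cst 0%R) harmonic).
  - by apply: nearW => n; have [/andP[/ltW -> ->]] := Hr n.
  - exact: cvg_cst.
  - exact: cvg_harmonic.
have ibox : (leb d).-integrable setT (EFin \o @box R d).
  apply: (ge0_integrable (@box R d)); [exact: box_ge0|exact: measurable_box|].
  by rewrite integral_box ltry.
have prod0 n (x : d.-tuple R) : 0 <= (g x)%:E * box_shift_dist (tscale (r n) x).
  by rewrite mule_ge0 ?box_shift_dist_ge0// lee_fin.
have : \int[leb d]_x ((g x)%:E * box_shift_dist (tscale (r n) x)) @[n --> \oo] --> 0.
  have := @dominated_convergence _ _ _ (leb d) setT measurableT
    (fun n x => (g x)%:E * box_shift_dist (tscale (r n) x)) (cst 0)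
    (fun x => 2%:E * (g x)%:E).
  case.
  - move=> n; apply: emeasurable_funM; first exact/measurable_EFinP.
    exact: measurable_box_shift_dist.
  - exact: measurable_cst.
  - apply: aeW => x _; rewrite /cst -[X in _ --> X](mule0 (g x)%:E).
    apply: cvgeZl => //; apply: leb_translation_cvg => // i.
    rewrite (_ : (fun n => _) = (fun n => - tnth x i * r n)%R); last first.
      by apply/funext => n; rewrite !tnth_mktuple; ring.
    by rewrite -[X in _ --> X](mulr0 (- tnth x i)%R); apply: cvgM => //; exact: cvg_cst.
  - by apply: integrableZl => //; exact: ge0_integrable.
  - apply: aeW => x n _; rewrite gee0_abs// muleC lee_wpmul2r ?lee_fin//.
    exact: box_shift_dist_le2.
  by move=> _ _; rewrite integral0.
move/ge0_cvge0P => /(_ (fun n => integral_ge0 _ (fun x _ => prod0 n x)) _ e0)[N _ /(_ N (leqnn N))].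
exact: (Hr N).2.
Qed.

End dilation_limits.

(** * The lower bound for some translate *)

Section dilation_lower.
Context {R : realType} {d : nat}.
Local Open Scope ereal_scope.
Implicit Types (f g h : d.-tuple R -> R).

(* Recentring the cube amounts to translating the box in the rescaled variable. *)
Lemma avg_recentre_le f (L r : R) (y w0 : d.-tuple R) : Sd f ->
  avg f w0 L <= avg f (tadd (tscale (L * r) y) w0) L + box_shift_dist (tscale r y).
Proof.
move=> [mf f01].
pose h w := f (tadd (tscale L w) w0).
have mh : measurable_fun setT h by exact: measurable_aff.
have := integral_shift_le h box (tscale r y) mh (fun x => f01 _)
  (@measurable_box R d) (@box_ge0 R d).
congr (_ <= _ + _).
  by apply: eq_integral => w _; rewrite mulrC.
apply: eq_integral => w _; rewrite mulrC; congr (_ * f _)%:E.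
by apply: eq_from_tnth => i; rewrite !tnth_mktuple; ring.
Qed.

(** The side [L] is chosen after [t], so any positive [t] is small relative to it. If every
    translate in a cube fell short by [e], so would their average, which falls short by at most
    [e / 2]. *)
Lemma le_integral_dil f g (e t : R) : Sd f -> measurable_fun setT g ->
  (forall x, 0 <= g x)%R -> \int[leb d]_x (g x)%:E < +oo -> (0 < e)%R -> (0 < t)%R ->
  exists v, (fine (upper_banach_density f))%:E * \int[leb d]_y (g y)%:E <=
    \int[leb d]_y (f (tscale t (tadd y v)) * g y)%:E + e%:E.
Proof.
move=> fS mg g0 gfin e0 t0; have [mf f01] := fS.
have f0 x : (0 <= f x)%R by case/andP: (f01 x).
set D := fine _; set A := integral _ _ _.
have D0 : (0 <= D)%R.
  by rewrite fine_ge0//; case/andP: (upper_banach_density_bounds _ f fS).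
have A0 : 0 <= A by apply: integral_ge0 => x _; rewrite lee_fin.
have Afin : A \is a fin_num by rewrite ge0_fin_numE.
pose I := fine A; have AE : A = I%:E by rewrite fineK.
have I0 : (0 <= I)%R by rewrite fine_ge0.
have e40 : (0 < e / 4)%R by rewrite divr_gt0.
have eta0 : (0 < e / 4 / (I + 1))%R by rewrite divr_gt0// ltr_wpDl.
have [s s0 Hs] := integral_box_shift_dist_small g _ mg g0 gfin e40.
(* A side beyond [t / s] makes the ratio [r = t / L] at most [s]. *)
have [L tsL [w0 Hw0]] := avg_lower _ f fS _ _ eta0 (divr_gt0 t0 s0).
have L0 : (0 < L)%R by apply: lt_trans tsL; rewrite divr_gt0.
pose r := (t / L)%R.
have Lr : (L * r)%R = t by rewrite /r mulrC divfK// gt_eqF.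
have {}Hs : \int[leb d]_x ((g x)%:E * box_shift_dist (tscale r x)) <= (e / 4)%:E.
  apply: Hs; rewrite divr_gt0//= ler_pdivrMr// mulrC -ler_pdivrMr//; exact: ltW.
pose c (y : d.-tuple R) := tadd (tscale t y) w0.
have mc : measurable_fun setT c by apply: measurable_tadd => //; exact: measurable_tscale.
have mge : measurable_fun setT (fun y => (g y)%:E) by exact/measurable_EFinP.
have ge0 y : 0 <= (g y)%:E by rewrite lee_fin.
have mav : measurable_fun setT (fun y => avg f (c y) L) by exact: measurable_avg.
have mB : measurable_fun setT (fun w : d.-tuple R => (box w)%:E).
  by apply/measurable_EFinP; exact: measurable_box.
have B0 (w : d.-tuple R) : 0 <= (box w)%:E by rewrite lee_fin box_ge0.
have mth := @measurable_box_shift_dist R d r.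
pose eta : R := (e / 4 / (I + 1))%R.
pose Phi w := \int[leb d]_y (f (tadd (tscale L w) (c y)) * g y)%:E.
have mPhi : measurable_fun setT Phi by exact: measurable_integral_aff.
have Phi0 w : 0 <= Phi w by apply: integral_ge0 => y _; rewrite lee_fin mulr_ge0.
have main : (D * I)%:E <= \int[leb d]_w ((box w)%:E * Phi w) + (e / 2)%:E.
  rewrite integral_box_swap// EFinM -AE /A -ge0_integralZl//.
  (* For each [y], the density exceeds the average about [w0] by at most [eta], and that one exceeds
     the average about [c y] by at most the box distance. *)
  apply: (@le_trans _ _ (\int[leb d]_y (avg f (c y) L * (g y)%:E +
      ((g y)%:E * box_shift_dist (tscale r y) + eta%:E * (g y)%:E)))).
    apply: ge0_le_integral => //.
    - by move=> y _; rewrite -EFinM lee_fin mulr_ge0.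
    - exact: emeasurable_funM.
    - apply: emeasurable_funD; first exact: emeasurable_funM.
      by apply: emeasurable_funD; exact: emeasurable_funM.
    - move=> y _; have th0 := box_shift_dist_ge0 (tscale r y).
      have eta0' : 0 <= eta%:E by rewrite lee_fin ltW.
      have sum0 := adde_ge0 th0 eta0'; have av0 := avg_ge0 _ f (c y) L fS.
      rewrite [X in _ + (X + _)]muleC -(ge0_muleDl _ th0 eta0') -(ge0_muleDl _ av0 sum0).
      apply: lee_wpmul2r => //; apply: (le_trans Hw0); rewrite addeA leeD2r//.
      by rewrite /c -{1}Lr; exact: avg_recentre_le.
  rewrite ge0_integralD//; last 4 first.
  - by move=> y _; rewrite mule_ge0 ?avg_ge0.
  - exact: emeasurable_funM.
  - by move=> y _; rewrite adde_ge0// mule_ge0 ?box_shift_dist_ge0 ?lee_fin ?(ltW eta0).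
  - by apply: emeasurable_funD; exact: emeasurable_funM.
  apply: leeD2l; rewrite ge0_integralD//; last 4 first.
  - by move=> y _; rewrite mule_ge0 ?box_shift_dist_ge0.
  - exact: emeasurable_funM.
  - by move=> y _; rewrite mule_ge0 ?lee_fin ?(ltW eta0).
  - exact: emeasurable_funM.
  rewrite (_ : e / 2 = e / 4 + e / 4)%R; last by field.
  rewrite EFinD; apply: leeD => //.
  rewrite ge0_integralZl// ?lee_fin ?(ltW eta0)// -/A AE -EFinM lee_fin.
  rewrite /eta mulrAC ler_pdivrMr ?ltr_wpDl//; apply: ler_wpM2l; first exact: ltW.
  by rewrite lerDl.
apply: contrapT => H.
have HPhi w : Phi w + e%:E < (D * I)%:E.
  rewrite ltNge; apply/negP => Hw; apply: H.
  (* The vector [v] with [t v = L w + w0], which turns [Phi w] into the integral sought. *)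
  exists (tscale t^-1 (tadd (tscale L w) w0)); rewrite AE -EFinM.
  apply: (le_trans Hw); rewrite leeD2r// le_eqVlt; apply/orP; left; apply/eqP.
  apply: eq_integral => y _; congr (f _ * _)%:E; apply: eq_from_tnth => i.
  by rewrite !tnth_mktuple mulrDr mulVKf ?gt_eqF//; ring.
(* Nonnegativity of [Phi] gives this; it allows the constant to be written as an average against the
   box. *)
have DIe : (0 <= D * I - e)%R.
  rewrite subr_ge0 -lee_fin; apply: le_trans (ltW (HPhi w0)); exact: leeDr.
have : \int[leb d]_w ((box w)%:E * Phi w) <= (D * I - e)%:E.
  rewrite -[leRHS](integral_box_scale d) ?lee_fin//; apply: ge0_le_integral => //.
  - by move=> w _; rewrite mule_ge0.
  - exact: emeasurable_funM.
  - exact: emeasurable_funM.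
  - move=> w _; apply: lee_wpmul2l => //; rewrite EFinB leeBrDr//; exact: ltW.
move=> /(leeD2r (e / 2)%:E)/(le_trans main); rewrite -EFinD lee_fin; lra.
Qed.

End dilation_lower.

(** * Signed test functions and near-equality *)

Section assembly.
Context {R : realType} {d : nat}.
Implicit Types (f g h : d.-tuple R -> R).

Lemma measurable_posp g : measurable_fun setT g -> measurable_fun setT (posp g).
Proof. by move=> mg; exact: measurable_maxr. Qed.

Lemma measurable_negp g : measurable_fun setT g -> measurable_fun setT (negp g).
Proof. by move=> mg; apply: measurable_maxr => //; exact: measurableT_comp. Qed.

(** The boolean makes all positive and negative parts one family over a finite type. *)
Definition part g (b : bool) := if b then posp g else negp g.

Lemma measurable_part g b : measurable_fun setT g -> measurable_fun setT (part g b).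
Proof. by case: b; [exact: measurable_posp|exact: measurable_negp]. Qed.

Lemma part_ge0 g b x : 0 <= part g b x.
Proof. by case: b; rewrite /part/posp/negp le_max lexx orbT. Qed.

Lemma part_le_norm g b x : part g b x <= `|g x|.
Proof.
by case: b; rewrite /part/posp/negp ge_max normr_ge0 andbT ?ler_norm// -normrN ler_norm.
Qed.

Lemma integral_part_lty g b : integrable_d g ->
  (\int[leb d]_x (part g b x)%:E < +oo)%E.
Proof.
move=> [mg]; rewrite iintE//; last first.
  by apply/measurable_EFinP; exact: measurableT_comp.
apply: le_lt_trans; apply: ge0_le_integral => //.
- by move=> x _; rewrite lee_fin part_ge0.
- by apply/measurable_EFinP; exact: measurable_part.
- by apply/measurable_EFinP; exact: measurableT_comp.
- by move=> x _; rewrite lee_fin part_le_norm.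
Qed.

Lemma pairingE h g : measurable_fun setT h -> (forall x, 0 <= h x) ->
  measurable_fun setT g ->
  pairing h g = (\int[leb d]_x (h x * part g true x)%:E -
                 \int[leb d]_x (h x * part g false x)%:E)%E.
Proof.
move=> mh h0 mg.
have H b : iint (fun x => (h x * part g b x)%:E) = (\int[leb d]_x (h x * part g b x)%:E)%E.
  rewrite iintE//.
    by apply/measurable_EFinP; apply: measurable_funM => //; exact: measurable_part.
  by move=> x; rewrite lee_fin mulr_ge0// part_ge0.
by rewrite -!H.
Qed.

(** Translating back by [-v] recovers [h]. *)
Lemma T_invariant_transl (B : set (d.-tuple R -> R)) v h :
  T_invariant B -> B (transl v h) -> B h.
Proof.
move=> TB Bh; rewrite -(TB (tscale (-1) v)); exists (transl v h) => //.
by apply/funext => x; rewrite /transl taddK.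
Qed.

Lemma Sd_transl_dil f v t : Sd f -> Sd (transl v (dil t f)).
Proof.
move=> [mf f01]; split=> [|x]; last exact: f01.
apply: (measurableT_comp (g := fun x => tscale t (tadd x v)) mf).
by apply: measurable_tscale; exact: measurable_tadd.
Qed.

(* The upper bound holds for each summand, so near-equality for the sum forces
   near-equality for each summand. *)
Lemma near_equality_summands (J : finType) (x a : J -> R) (e : R) : 0 < e ->
  (forall j, x j <= a j + e) -> \sum_j a j <= \sum_j x j + e ->
  forall j, `|x j - a j| <= e *+ #|J|.+1.
Proof.
move=> e0 xa ax j.
(* The other summands contribute at most [#|J|] errors; the error in the total adds the last one. *)
have : \sum_(k | k != j) x k <= \sum_(k | k != j) a k + e *+ #|J|.
  apply: (@le_trans _ _ (\sum_(k | k != j) (a k + e))); first exact: ler_sum.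
  rewrite big_split/= lerD2l (sumr_const [pred k | k != j]) ler_wpMn2l ?(ltW e0)//.
  exact: max_card.
move: ax (xa j); rewrite (bigD1 j)//= [in X in _ <= X -> _](bigD1 j)//= mulrSr => ax xj sx.
have eJ : 0 <= e *+ #|J| by rewrite mulrn_wge0// ltW.
by rewrite ler_norml; apply/andP; split; lra.
Qed.

Lemma dist_sub_lt (x x' y y' e : R) : 0 < e ->
  `|x - x'| <= e / 4 -> `|y - y'| <= e / 4 -> `|x - y - (x' - y')| < e.
Proof.
rewrite !ler_norml ltr_norml => e0 /andP[? ?] /andP[? ?].
by apply/andP; split; lra.
Qed.

(** The lower bound for the sum of the [p j] yields a single [v]; the upper bounds hold at every
    [v], hence at this one. *)
Lemma exists_translate_near f (J : finType) (p : J -> d.-tuple R -> R) (e : R) :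
  Sd f -> (forall j, measurable_fun setT (p j)) -> (forall j x, 0 <= p j x) ->
  (forall j, \int[leb d]_x (p j x)%:E < +oo)%E -> 0 < e ->
  exists T : R, forall t, T < t -> exists v, forall j,
    (`|\int[leb d]_x (transl v (dil t f) x * p j x)%:E -
       (fine (upper_banach_density f))%:E * \int[leb d]_x (p j x)%:E| <= e%:E)%E.
Proof.
move=> fS mp p0 pfin e0; have [mf f01] := fS.
have f0 x : 0 <= f x by case/andP: (f01 x).
set D := fine _.
(* This is the share that [near_equality_summands] multiplies back to [e]. *)
have e'0 : 0 < e / #|J|.+1%:R by rewrite divr_gt0.
have HU j := integral_dil_le f (p j) _ fS (mp j) (p0 j) (pfin j) e'0.
have /choice[T HT] : forall j, exists T : R, 0 <= T /\ forall t v, T < t ->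
    (\int[leb d]_y (f (tscale t (tadd y v)) * p j y)%:E <=
    D%:E * \int[leb d]_y (p j y)%:E + (e / #|J|.+1%:R)%:E)%E.
  by move=> j; have [T T0 HT] := HU j; exists T.
(* The thresholds are nonnegative, so their sum dominates each of them and forces [t] to be
   positive. *)
exists (\sum_j T j) => t tT.
have t0 : 0 < t by apply: le_lt_trans tT; apply: sumr_ge0 => j _; exact: (HT j).1.
have tTj j : T j < t.
  apply: le_lt_trans tT; rewrite (bigD1 j)//= lerDl.
  by apply: sumr_ge0 => k _; exact: (HT k).1.
have mpe j : measurable_fun setT (fun x => (p j x)%:E) by exact/measurable_EFinP.
have sumE (q : J -> d.-tuple R -> R) : (forall j, measurable_fun setT (q j)) ->
    (forall j x, 0 <= q j x) ->
    (\int[leb d]_x (\sum_j q j x)%:E = \sum_j \int[leb d]_x (q j x)%:E)%E.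
  move=> mq q0; rewrite -ge0_integral_sum//.
  - by apply: eq_integral => x _; rewrite sumEFin.
  - by move=> j; exact/measurable_EFinP.
  - by move=> j x _; rewrite lee_fin.
have Gfin : (\int[leb d]_x (\sum_j p j x)%:E < +oo)%E.
  by rewrite sumE//; apply/lte_sum_pinfty => j _.
have mG : measurable_fun setT (fun x => \sum_j p j x) by exact: measurable_sum.
have G0 x : 0 <= \sum_j p j x by exact: sumr_ge0.
have [v Hv] := le_integral_dil f _ _ t fS mG G0 Gfin e'0 t0.
exists v; set h := transl v (dil t f).
have [mh h01] : Sd h by exact: Sd_transl_dil.
have h0 x : 0 <= h x by case/andP: (h01 x).
pose A j := (\int[leb d]_x (p j x)%:E)%E.
pose X j := (\int[leb d]_x (h x * p j x)%:E)%E.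
have A0 j : (0 <= A j)%E by apply: integral_ge0 => x _; rewrite lee_fin.
have X0 j : (0 <= X j)%E by apply: integral_ge0 => x _; rewrite lee_fin mulr_ge0.
have Afin j : A j \is a fin_num by rewrite ge0_fin_numE//; exact: pfin.
have XA j : (X j <= D%:E * A j + (e / #|J|.+1%:R)%:E)%E by exact: (HT j).2.
have Xfin j : X j \is a fin_num.
  rewrite ge0_fin_numE//; apply: le_lt_trans (XA j) _.
  by rewrite -(fineK (Afin j)) -EFinM -EFinD ltry.
move: Hv; rewrite sumE//.
under [X in (_ <= X + _)%E]eq_integral do rewrite mulr_sumr.
rewrite (sumE (fun j x => f (tscale t (tadd x v)) * p j x)); last 2 first.
- by move=> j; exact: measurable_funM.
- by move=> j x; rewrite mulr_ge0.
move=> Hv j; rewrite -/(A j) -/(X j) -(fineK (Afin j)) -(fineK (Xfin j)).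
rewrite -EFinM -EFinB lee_fin.
have -> : e = (e / #|J|.+1%:R) *+ #|J|.+1 by rewrite -mulr_natr divfK// pnatr_eq0.
apply: (near_equality_summands _ (fun j => fine (X j)) (fun j => D * fine (A j))) => // [k|].
  by rewrite -lee_fin EFinD EFinM (fineK (Xfin k)) (fineK (Afin k)); exact: XA.
have sumF (Y : J -> \bar R) : (forall j, Y j \is a fin_num) ->
    (\sum_j Y j = (\sum_j fine (Y j))%:E)%E.
  by move=> Yfin; rewrite -sumEFin; apply: eq_bigr => k _; rewrite fineK.
have {}Hv : (D%:E * \sum_j A j <= \sum_j X j + (e / #|J|.+1%:R)%:E)%E by exact: Hv.
by rewrite !sumF// -EFinM -EFinD lee_fin mulr_sumr in Hv.
Qed.

End assembly.

Theorem theorem2p1 (R : realType) (d : nat) (hd : (0 < d)%N)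
  (f : d.-tuple R -> R) (V : set (d.-tuple R -> R)) :
  Sd f ->
  T_invariant V ->
  weakstar_open_in_Sd V ->
  V (fun _ => fine (upper_banach_density f)) ->
  exists T : R, forall t : R, T < t -> V (dil t f).
Proof.
move=> fS TV [VS Vopen] VD; set D := fine _ in VD.
have [n [gs [eps [igs [eps0 HV]]]]] := Vopen _ VD.
have [mD D01] := VS _ VD.
have D0 : 0 <= D by case/andP: (D01 [tuple 0 | i < d]).
pose p (j : 'I_n * bool) := part (gs j.1) j.2.
have mp j : measurable_fun setT (p j) by apply: measurable_part; case: (igs j.1).
have pfin j : (\int[leb d]_x (p j x)%:E < +oo)%E by exact: integral_part_lty.
(* A pairing is a difference of two parts; two errors of [eps / 4] stay strictly below [eps]. *)
have eps4 : 0 < eps / 4 by rewrite divr_gt0.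
have [T HT] := exists_translate_near f _ p _ fS mp (fun j => part_ge0 _ _) pfin eps4.
exists T => t /HT[v Hv].
(* Only the translate by [v] is shown to lie in the weak-* neighbourhood; invariance brings
   [dil t f] itself into [V]. *)
apply: (T_invariant_transl _ v _ TV); set h := transl v (dil t f) in Hv *.
have hS : Sd h by exact: Sd_transl_dil.
have [mh h01] := hS.
have h0 x : 0 <= h x by case/andP: (h01 x).
apply: HV => // i; have mg : measurable_fun setT (gs i) by case: (igs i).
rewrite (pairingE h)// (pairingE (fun _ => D))//.
have Aint b : (\int[leb d]_x (D * part (gs i) b x)%:E =
    D%:E * \int[leb d]_x (part (gs i) b x)%:E)%E.
  rewrite -ge0_integralZl//.
  - by apply/measurable_EFinP; exact: measurable_part.
  - by move=> x _; rewrite lee_fin part_ge0.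
rewrite !Aint; have := Hv (i, false); have := Hv (i, true); rewrite /p /=.
have Afin b : (\int[leb d]_x (part (gs i) b x)%:E)%E \is a fin_num.
  rewrite ge0_fin_numE; first exact: (pfin (i, b)).
  by apply: integral_ge0 => x _; rewrite lee_fin part_ge0.
have Xfin b : (\int[leb d]_x (h x * part (gs i) b x)%:E)%E \is a fin_num.
  rewrite ge0_fin_numE; last first.
    by apply: integral_ge0 => x _; rewrite lee_fin mulr_ge0// part_ge0.
  apply: le_lt_trans (pfin (i, b)); apply: ge0_le_integral => //.
  - by move=> x _; rewrite lee_fin mulr_ge0// part_ge0.
  - by apply/measurable_EFinP; apply: measurable_funM => //; exact: measurable_part.
  - exact/measurable_EFinP.
  - by move=> x _; rewrite lee_fin ler_piMl ?part_ge0//; case/andP: (h01 x).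
rewrite -(fineK (Afin true)) -(fineK (Afin false)) -(fineK (Xfin true)) -(fineK (Xfin false)).
rewrite -!EFinM -!EFinB -/D !abse_EFin !lee_fin lte_fin.
exact: dist_sub_lt.
Qed.
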